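(* Let $G$ be a simple strongly even-cycle decomposable graph and let $u$ and $v$ be adjacent twin vertices of $G$ having degree at least $4$. If $H$ is a simple anti-Eulerian graph, then the twin substitution of $\{u,v\}$ by $H$ in $G$ is strongly even-cycle decomposable.
   Context: All graphs are finite and have at least one vertex. An anti-Eulerian graph is a graph in which every vertex has odd degree. A graph is even-cycle decomposable if its edge set can be partitioned into (edge sets of) cycles of even length. A subdivision of a graph is obtained by replacing each edge by a path of length at least $1$ with the same ends (so a graph is a subdivision of itself). A graph $G$ is strongly even-cycle decomposable if every subdivision of $G$ with an even number of edges is even-cycle decomposable. Equivalently, for every $\Sigma\subseteq E(G)$ with $|\Sigma|$ even, $E(G)$ can be partitioned into cycles each containing an even number of edges of $\Sigma$. Two distinct vertices $u,v$ of a graph $G$ are twins if no vertex in $V(G)\setminus\{u,v\}$ is adjacent to exactly one of $u$ and $v$. If $u$ and $v$ are twins of $G$ and $H$ is a simple graph, the twin substitution of $\{u,v\}$ by $H$ in $G$ is the graph obtained from the disjoint union of $G-u-v$ and $H$ by adding an edge $xy$ for all $x\in V(H)$ and all neighbors $y\in V(G)\setminus\{u,v\}$ of $v$. *)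

(* Defs.v *)
From mathcomp Require Import all_boot.

Set Implicit Arguments.
Unset Strict Implicit.
Unset Printing Implicit Defensive.

Record sgraph := SGraph {
  vertex :> finType;
  adj : rel vertex;
  adj_sym : symmetric adj;
  adj_irrefl : irreflexive adj;
  vertex_gt0 : 0 < #|vertex| }.

Arguments adj {s} _ _.

Definition degree (G : sgraph) (x : G) : nat := #|[set y | adj x y]|.

Definition anti_eulerian (G : sgraph) : Prop := forall x : G, odd (degree x).

Definition edges (G : sgraph) : {set {set G}} :=
  [set e | [exists x, exists y, adj x y && (e == [set x; y])]].

(* Subdivisions of simple graphs are simple, so cycles have length at least 3
   in [even_cycle]; for a cycle c of length at least 3 the set below has exactly
   [size c] elements. *)
Definition cycle_edges (G : sgraph) (c : seq G) : {set {set G}} :=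
  [set [set x; next c x] | x in c].

Definition even_cycle (G : sgraph) (C : {set {set G}}) : Prop :=
  exists c : seq G,
    [/\ 2 < size c, ucycle adj c, ~~ odd (size c) & C = cycle_edges c].

Definition even_cycle_decomposable (G : sgraph) : Prop :=
  exists2 P : {set {set {set G}}},
    partition P (edges G) & forall C, C \in P -> even_cycle C.

Definition walk_edges (G : sgraph) (w : seq G) : seq {set G} :=
  [seq [set ab.1; ab.2] | ab <- zip w (behead w)].

(* [f] embeds the vertices of G in S, and the edge xy of G is replaced by the
   path f x, p x y, f y of S, where [p x y] lists its internal vertices in order
   from f x to f y; so p x y = [::] when the edge is left as it is. The values
   of p at non-adjacent pairs are irrelevant. *)
Definition sub_path (G S : sgraph) (f : G -> S) (p : G -> G -> seq S)
    (x y : G) : seq S := f x :: rcons (p x y) (f y).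

Record subdivision_by (G S : sgraph) (f : G -> S) (p : G -> G -> seq S) :
    Prop := SubdivisionBy {
  sub_inj : injective f;
  sub_rev : forall x y, adj x y -> p y x = rev (p x y);
  sub_uniq : forall x y, adj x y -> uniq (sub_path f p x y);
  sub_new : forall x y z, adj x y -> f z \notin p x y;
  sub_disj : forall x y x' y' s, adj x y -> adj x' y' ->
    s \in p x y -> s \in p x' y' -> [set x; y] = [set x'; y'];
  sub_vertex : forall s : S,
    (exists x, s = f x) \/ (exists x y, adj x y /\ s \in p x y);
  sub_edge : forall e : {set S},
    e \in edges S <->
    (exists x y, adj x y /\ e \in walk_edges (sub_path f p x y)) }.

Definition subdivision (G S : sgraph) : Prop :=
  exists (f : G -> S) (p : G -> G -> seq S), subdivision_by f p.

Definition strongly_even_cycle_decomposable (G : sgraph) : Prop :=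
  forall S : sgraph,
    subdivision G S -> ~~ odd #|edges S| -> even_cycle_decomposable S.

Definition twins (G : sgraph) (u v : G) : Prop :=
  u != v /\ forall w, w != u -> w != v -> adj u w = adj v w.

Section TwinSubstitution.

Variables (G : sgraph) (u v : G) (H : sgraph).

Definition twin_subst_vertex : finType :=
  ({x : G | (x != u) && (x != v)} + H)%type.

Definition twin_subst_adj : rel twin_subst_vertex := fun a b =>
  match a, b with
  | inl x, inl y => adj (val x) (val y)
  | inr x, inr y => adj x y
  | inr _, inl y | inl y, inr _ => adj v (val y)
  end.

Lemma twin_subst_sym : symmetric twin_subst_adj.
Proof. by case=> [x|x] [y|y] //=; apply: adj_sym. Qed.

Lemma twin_subst_irrefl : irreflexive twin_subst_adj.
Proof. by case=> x /=; apply: adj_irrefl. Qed.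

Lemma twin_subst_gt0 : 0 < #|twin_subst_vertex|.
Proof. by rewrite card_sum addn_gt0 vertex_gt0 orbT. Qed.

Definition twin_subst : sgraph :=
  SGraph twin_subst_sym twin_subst_irrefl twin_subst_gt0.

End TwinSubstitution.

(* Main.v *)
Require Import Defs.
From mathcomp Require Import all_boot ring.

(** A subdivision only matters through the parities of its paths, so the statement
    is about signed graphs whose total sign is even, to be cut into even cycles.
    Multigraphs H are allowed. An even cycle of H can be discarded; if H has none,
    the ends of a maximal path of H are leaves, since a further edge there would
    create a theta, one of whose three cycles is even. If H = K_2 the graph is G.
    Otherwise H either has leaves y, w with distinct neighbours x, z, or three leaves
    at the same vertex. In the first case delete y and w, add a virtual edge xz with
    the sign making the total even, and decompose by induction; the cycle through xz
    yields a path from y to w, which together with the edges from y and w to the odd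
    set N (|N| >= 3) of outer neighbours always splits into even cycles, even if the
    path meets N. In the second case two of the leaves carry equal parities, and the
    path of length 2 between them plays the same role. *)

Set Implicit Arguments.
Unset Strict Implicit.
Unset Printing Implicit Defensive.

(** * Signed multigraphs and suppression of vertices of degree 2 *)

(** Parallel edges are forced by the induction: [xz] may already be an edge of H, so edge lists
    carry multiplicities and two parallel edges form a cycle. Both reductions keep the degrees of H
    odd: the virtual edge gives back what x and z lose, while a common neighbour loses two. At a
    common neighbour a virtual edge would be a loop, so no sign can be chosen freely there; this is
    why equal parities are needed.

    N is odd with at least three elements because a strongly decomposable graph has even degrees and
    v has exactly one neighbour, u, besides its outer ones.

    A path from y to w with its fan splits as follows. Each n in N gives a path y n w of some
    parity, and the sum of these parities is that of the given path. Three of them already have this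
    sum; the others are even in number with even sum, so they pair up, by equal parity, into even
    4-cycles. For the path with three vertices of N, only the order in which it meets them matters,
    since its other vertices can be suppressed. Four small graphs remain, according to how many are
    met, and each has a short list of decompositions that serves all even signatures. *)

Section SignedMultigraph.

Variable V : finType.
Implicit Types (x y a b m v w : V) (p q : seq (bool * V)).
Implicit Types (c L : seq ({set V} * bool)).

(* A list of signed edges, with multiplicity; the sign [true] is odd. *)
Definition parity L := odd (count snd L).

Fixpoint wedges x p : seq ({set V} * bool) :=
  if p is (s, v) :: p' then ([set x; v], s) :: wedges v p' else [::].

Definition upath x p y := (last x (map snd p) == y) && uniq (x :: map snd p).

(** Length 2 is allowed, for two parallel edges, and length 1 is not, which rules out loops. The
    start is recorded once, as the last vertex visited, so that uniqueness can be required of the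
    whole list. *)
Definition closed_walk x p :=
  [&& 1 < size p, last x (map snd p) == x & uniq (map snd p)].

Definition is_cycle c := exists x p, closed_walk x p /\ perm_eq c (wedges x p).

Definition dec L := exists cs : seq (seq ({set V} * bool)),
  (forall c, c \in cs -> is_cycle c /\ ~~ parity c) /\ perm_eq (flatten cs) L.

Lemma parity_cat L1 L2 : parity (L1 ++ L2) = parity L1 (+) parity L2.
Proof. by rewrite /parity count_cat oddD. Qed.

Lemma parity_cons e L : parity (e :: L) = e.2 (+) parity L.
Proof. by rewrite /parity /= oddD; case: e.2. Qed.

Lemma parity_perm L1 L2 : perm_eq L1 L2 -> parity L1 = parity L2.
Proof. by move=> /permP h; rewrite /parity h. Qed.

Lemma wedges_cat x p q :
  wedges x (p ++ q) = wedges x p ++ wedges (last x (map snd p)) q.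
Proof. by elim: p x => [|[s v] p IH] x //=; rewrite IH. Qed.

Lemma wedges_vertex x p v :
  p != [::] -> v \in x :: map snd p -> exists2 e, e \in wedges x p & v \in e.1.
Proof.
elim: p x => [|[s u] p IH] x //= _; rewrite !inE.
case/or3P => [/eqP->|/eqP->|hv].
- by exists ([set x; u], s); rewrite ?inE /= ?inE eqxx.
- by exists ([set x; u], s); rewrite ?inE /= ?inE eqxx ?orbT.
have pn : p != [::] by case: (p) hv.
have [|e he hve] := IH u pn; first by rewrite inE hv orbT.
by exists e; rewrite // inE he orbT.
Qed.

Lemma wedges_sub x p e v : e \in wedges x p -> v \in e.1 -> v \in x :: map snd p.
Proof.
elim: p x => [|[s u] p IH] x //=; rewrite inE; case/orP => [/eqP-> /=|he hv].
  by rewrite !inE => /orP[]->; rewrite ?orbT.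
by have := IH _ he hv; rewrite !inE => /orP[]->; rewrite ?orbT.
Qed.

Lemma dec_perm L L' : perm_eq L L' -> dec L -> dec L'.
Proof. by move=> h [cs [hcs hL]]; exists cs; split => //; apply: perm_trans hL h. Qed.

Lemma dec_nil : dec [::].
Proof. by exists [::]. Qed.

Lemma dec_cat L1 L2 : dec L1 -> dec L2 -> dec (L1 ++ L2).
Proof.
move=> [cs1 [h1 e1]] [cs2 [h2 e2]]; exists (cs1 ++ cs2); split.
  by move=> c; rewrite mem_cat => /orP[/h1|/h2].
by rewrite flatten_cat perm_cat.
Qed.

Lemma dec_cycle c : is_cycle c -> ~~ parity c -> dec c.
Proof.
by move=> hc hp; exists [:: c]; split => [c'|]; rewrite /= ?cats0 // inE => /eqP->.
Qed.

Lemma dec_parity L : dec L -> ~~ parity L.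
Proof.
move=> [cs [h /parity_perm <-]].
elim: cs h => [|c cs IH] h //=.
rewrite parity_cat negb_add; have [_ hc] := h c (mem_head _ _).
have hcs : ~~ parity (flatten cs) by apply: IH => c' hc'; apply: h; rewrite inE hc' orbT.
by rewrite (negbTE hc) (negbTE hcs).
Qed.

Lemma dec_pick e L : dec L -> e \in L ->
  exists c L', [/\ is_cycle c, ~~ parity c, e \in c, dec L' & perm_eq L (c ++ L')].
Proof.
move=> [cs [h hL]]; rewrite -(perm_mem hL) => /flattenP [c hc he].
have [hc1 hc2] := h _ hc.
exists c, (flatten (rem c cs)); split => //.
  exists (rem c cs); split => // c' hc'; apply: h; exact: mem_rem hc'.
rewrite perm_sym; apply: perm_trans hL.
by rewrite -[c ++ _]/(flatten (c :: rem c cs)); apply: perm_flatten;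
   rewrite perm_sym perm_to_rem.
Qed.

Lemma upath_rev x p y : upath x p y ->
  exists2 q, upath y q x & perm_eq (wedges y q) (wedges x p)
     /\ perm_eq (y :: map snd q) (x :: map snd p).
Proof.
elim: p x => [|[s v] p IH] x.
  by move=> /andP[/eqP /= -> _]; exists [::] => //; rewrite /upath /= eqxx.
move=> /andP[/= hl /andP[hx hu]].
have [|q /andP[/eqP ql qu] [qw qv]] := IH v; first by rewrite /upath hl.
have hv : perm_eq (y :: map snd (rcons q (s, x))) (x :: v :: map snd p).
  rewrite map_rcons /= -rcons_cons perm_rcons perm_cons; exact: qv.
exists (rcons q (s, x)).
  by rewrite /upath (perm_uniq hv) map_rcons last_rcons eqxx /= hx.
split=> //.
by rewrite -cats1 wedges_cat ql /= cats1 perm_rcons setUC perm_cons.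
Qed.

Lemma split_wedges x p e : e \in wedges x p -> exists p1 s v p2,
  p = p1 ++ (s, v) :: p2 /\ e = ([set last x (map snd p1); v], s).
Proof.
elim: p x => [|[s u] p IH] x //=; rewrite inE; case/orP => [/eqP->|he].
  by exists [::], s, u, p.
have [p1 [s' [v [p2 [-> ->]]]]] := IH _ he.
by exists ((s, u) :: p1), s', v, p2.
Qed.

Lemma set2_eq a b u v : [set a; b] = [set u; v] ->
  (a = u /\ b = v) \/ (a = v /\ b = u).
Proof.
move=> h.
have: a \in [set u; v] by rewrite -h !inE eqxx.
have: b \in [set u; v] by rewrite -h !inE eqxx orbT.
have: u \in [set a; b] by rewrite h !inE eqxx.
have: v \in [set a; b] by rewrite h !inE eqxx orbT.
rewrite !inE => /orP[]/eqP h1 /orP[]/eqP h2 /orP[]/eqP h3 /orP[]/eqP h4;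
  by [left; split; congruence | right; split; congruence].
Qed.

(** A cycle without one of its edges is a path, which is reversed when the walk crosses the edge
    from [b] to [a]. *)
Lemma cycle_rotate c a b s : a != b -> is_cycle c -> ([set a; b], s) \in c ->
  exists2 p, upath b p a & perm_eq c (([set a; b], s) :: wedges b p).
Proof.
move=> nab [x [p [/and3P[hs /eqP hl hu] hc]]]; rewrite (perm_mem hc) => /split_wedges.
move=> [p1 [s' [v [p2 [ep [ee ->]]]]]].
have hlp : last v (map snd p2) = x by rewrite -hl ep map_cat last_cat.
set u := last x (map snd p1) in ee.
have pu : upath v (p2 ++ p1) u.
  rewrite /upath map_cat last_cat hlp eqxx andTb.
  by rewrite -[v :: _]/(map snd ((s', v) :: p2) ++ _) uniq_catC -map_cat -ep.
have pw : perm_eq c (([set u; v], s') :: wedges v (p2 ++ p1)).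
  apply: perm_trans hc _; rewrite ep wedges_cat /= -/u wedges_cat hlp.
  by rewrite -cat_cons perm_catC.
case: (set2_eq ee) => [] [ea eb]; first by exists (p2 ++ p1); rewrite ?ea ?eb.
have [q hq [hw _]] := upath_rev pu.
exists q; first by rewrite ea eb.
by rewrite ee; apply: perm_trans pw _; rewrite perm_cons eb perm_sym.
Qed.

Definition fresh m L := all (fun e : {set V} * bool => m \notin e.1) L.

Lemma freshP m L e : fresh m L -> e \in L -> m \notin e.1.
Proof. by move=> /allP; apply. Qed.

Lemma fresh_perm m L L' : perm_eq L L' -> fresh m L = fresh m L'.
Proof. by move=> h; apply: perm_all. Qed.

Lemma fresh_wedges m x p : fresh m (wedges x p) -> p != [::] -> m \notin x :: map snd p.
Proof.
move=> h hp; apply/negP => hm; have [e he] := wedges_vertex hp hm.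
by rewrite (negbTE (freshP h he)).
Qed.

Lemma upath_neq_nil a p b : a != b -> upath a p b -> p != [::].
Proof. by case: p => // /negbTE; rewrite /upath /= => ->. Qed.

(** Since [m] has degree 2, the cycle through [am] goes on along [mb]; as the signs are added,
    replacing the two edges by [ab], or conversely, keeps its parity. If [a] were [b], the two edges
    could form a cycle of length 2 that would shrink to a loop. *)
Lemma dec_suppress a m b s1 s2 L : m != a -> m != b -> a != b -> fresh m L ->
  dec (([set a; m], s1) :: ([set m; b], s2) :: L) <->
  dec (([set a; b], s1 (+) s2) :: L).
Proof.
move=> ma mb ab mL; split=> hd.
- have [c [L' [hc pc ec hL' hperm]]] := dec_pick hd (mem_head _ _).
  have am : a != m by rewrite eq_sym.
  have [p hp cp] := cycle_rotate am hc ec.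
  case: p hp cp => [/andP[/=]|[s v] p hp cp]; first by rewrite (negbTE ma).
  have hperm2 : perm_eq (([set m; b], s2) :: L) (([set m; v], s) :: wedges v p ++ L').
    have := perm_trans hperm (perm_cat cp (perm_refl L')).
    by rewrite /= perm_cons.
  have : ([set m; v], s) \in ([set m; b], s2) :: L.
    by rewrite (perm_mem hperm2) mem_head.
  rewrite inE => /orP[|/(freshP mL)]; last by rewrite !inE eqxx.
  move=> /eqP[/set2_eq h ?]; subst s.
  have ? : v = b by case: h => -[] // mb'; rewrite mb' eqxx in mb.
  subst v; move: hperm2; rewrite perm_cons => hperm2.
  apply: (@dec_perm ((([set a; b], s1 (+) s2) :: wedges b p) ++ L')).
    by rewrite /= perm_cons perm_sym.
  apply: dec_cat hL'; apply: dec_cycle.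
    exists a, ((s1 (+) s2, b) :: p); split => //.
    move: hp; rewrite /upath /= => /andP[hl /andP[_ hu]].
    rewrite /closed_walk /= hl hu !andbT ltnS.
    by case: (p) hl => //=; rewrite eq_sym (negbTE ab).
  move: pc; rewrite (parity_perm cp) /= !parity_cons /=.
  by rewrite -addbA.
have [c [L' [hc pc ec hL' hperm]]] := dec_pick hd (mem_head _ _).
have [p hp cp] := cycle_rotate ab hc ec.
have ba : b != a by rewrite eq_sym.
have pn := upath_neq_nil ba hp.
have hperm2 : perm_eq L (wedges b p ++ L').
  have := perm_trans hperm (perm_cat cp (perm_refl L')).
  by rewrite /= perm_cons.
have : fresh m (wedges b p ++ L') by rewrite -(fresh_perm _ hperm2).
rewrite /fresh all_cat => /andP[/fresh_wedges /(_ pn) mp _].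
apply: (@dec_perm ((([set a; m], s1) :: ([set m; b], s2) :: wedges b p) ++ L')).
  by rewrite /= !perm_cons perm_sym.
apply: dec_cat hL'; apply: dec_cycle.
  exists a, ((s1, m) :: (s2, b) :: p); split => //.
  by move: hp => /andP[hl hu]; rewrite /closed_walk /= hl mp; exact: hu.
move: pc; rewrite (parity_perm cp) /= !parity_cons /=.
by rewrite -addbA.
Qed.

(* [D] is the set of vertices that are kept. *)
Lemma dec_suppress_path (D : pred V) a p L :
  D a -> D (last a (map snd p)) -> uniq (a :: map snd p) ->
  (forall m, ~~ D m -> fresh m L) ->
  exists q, [/\ map snd q = filter D (map snd p),
    parity (wedges a q) = parity (wedges a p) &
    dec (wedges a q ++ L) <-> dec (wedges a p ++ L)].
Proof.
have [n] := ubnP (size p); elim: n p a L => // n IH [|[s v] p] a L.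
  by move=> *; exists [::].
rewrite ltnS /= => hn Da Dl /andP[hav /andP[hv hu]] hL.
have [Dv|nDv] := boolP (D v).
  (* The edge into a kept vertex joins the context, whose ends then still avoid all dropped
     vertices. *)
  have [||//||m hm|q [h1 h2 h3]] := IH p v (([set a; v], s) :: L).
  - exact: hn.
  - exact: Dv.
  - by rewrite /= hv.
  - rewrite /fresh /=; apply/andP; split; last exact: hL.
    by rewrite !inE; apply/norP; split; apply: contraNneq hm => ->.
  exists ((s, v) :: q); split => //=; first by rewrite h1.
    by rewrite !parity_cons h2.
  have pp r : perm_eq (wedges v r ++ ([set a; v], s) :: L)
                      (([set a; v], s) :: wedges v r ++ L).
    by rewrite -cat1s perm_catCA.
  split=> h.
    by apply: dec_perm (pp _) _; apply/h3; apply: dec_perm h; rewrite perm_sym.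
  by apply: dec_perm (pp _) _; apply/h3; apply: dec_perm h; rewrite perm_sym.
(* The last vertex is kept, so an edge follows [v]; it is merged with the edge [av], and the shorter
   walk is treated from [a] again. *)
case: p hn Dl hav hv hu => [_ /= hD|[s2 v2] p hn Dl hav hv hu]; first by rewrite hD in nDv.
have [||//||m hm|q [h1 h2 h3]] := IH ((s (+) s2, v2) :: p) a L.
- exact: hn.
- exact: Da.
- by move: hav hu; rewrite /= !inE !negb_or => /and3P[_ -> ->].
- exact: hL.
exists q; split.
- by rewrite h1.
- by rewrite h2 /= !parity_cons /= addbA.
apply: (iff_trans h3); apply: iff_sym; apply: dec_suppress.
- by apply: contraNneq nDv => ->.
- by move: hv; rewrite /= inE negb_or => /andP[].
- by move: hav; rewrite /= !inE !negb_or => /and3P[].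
rewrite /fresh all_cat; apply/andP; split; last exact: hL.
apply/allP => e he.
apply: contra hv => /(wedges_sub he) //.
Qed.

End SignedMultigraph.

(** * Fans: two vertices joined to an odd set and to each other by a path *)

(* A closed walk is encoded as its start and a list of pairs
   (index of an edge in [E], next vertex). *)
Fixpoint is_walk (E : seq (nat * nat)) x (st : seq (nat * nat)) :=
  if st is (k, v) :: st' then
    [&& k < size E, (nth (0, 0) E k == (x, v)) || (nth (0, 0) E k == (v, x))
      & is_walk E v st']
  else true.

Definition is_ncycle n E (c : nat * seq (nat * nat)) :=
  [&& is_walk E c.1 c.2, 1 < size c.2, last c.1 (map snd c.2) == c.1,
      uniq (map snd c.2) & all (fun v => v < n) (map snd c.2)].

Definition is_ndec n E (D : seq (nat * seq (nat * nat))) :=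
  all (is_ncycle n E) D &&
  perm_eq (flatten [seq map fst c.2 | c <- D]) (iota 0 (size E)).

(** Plain recursion, so that [vm_compute] can run through all signatures of a fan. *)
Fixpoint forall_bits m (P : seq bool -> bool) :=
  if m is m'.+1 then
    forall_bits m' (fun t => P (true :: t)) && forall_bits m' (fun t => P (false :: t))
  else P [::].

Lemma forall_bitsP m P : forall_bits m P -> forall t, size t = m -> P t.
Proof.
elim: m P => [|m IH] P /= h [|b t] //= [ht].
by case/andP: h => h1 h2; case: b; [apply: IH h1 _ ht | apply: IH h2 _ ht].
Qed.

(* [Ds] contains, for every even signature of [E], an even decomposition. *)
Definition covers n E Ds :=
  all (is_ndec n E) Ds && forall_bits (size E) (fun t => ~~ odd (count id t) ==>
    has (all (fun c : nat * seq (nat * nat) =>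
           ~~ odd (count (nth false t) (map fst c.2)))) Ds).

(** * From numbered graphs to signed multigraphs on any vertex set *)

Section Concrete.

Variables (V : finType) (x0 : V) (s : seq V) (E : seq (nat * nat)) (t : seq bool).

Definition nedge k : {set V} * bool :=
  ([set nth x0 s (nth (0, 0) E k).1; nth x0 s (nth (0, 0) E k).2], nth false t k).

Lemma nedge_walk x st : is_walk E x st ->
  wedges (nth x0 s x) [seq (nth false t k.1, nth x0 s k.2) | k <- st]
    = map nedge (map fst st).
Proof.
elim: st x => [|[k v] st IH] x //= /and3P[_ hk /IH ->]; congr (_ :: _).
by rewrite /nedge; case/orP: hk => /eqP -> //=; rewrite setUC.
Qed.

Lemma covers_dec Ds : uniq s -> size t = size E -> covers (size s) E Ds ->
  ~~ odd (count id t) -> dec (map nedge (iota 0 (size E))).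
Proof.
move=> us st /andP[/allP hD /forall_bitsP hcov] et.
have /implyP/(_ et)/hasP[D inD /allP eD] := hcov t st.
have /andP[/allP cD pD] := hD _ inD.
exists [seq map nedge (map fst c.2) | c : nat * seq (nat * nat) <- D]; split; last first.
  have -> : flatten [seq map nedge (map fst c.2) | c : nat * seq (nat * nat) <- D]
          = map nedge (flatten [seq map fst c.2 | c <- D]).
    by rewrite map_flatten -map_comp.
  exact: perm_map.
move=> _ /mapP[c hc ->]; have /and5P[hw h1 /eqP hl hu /allP ha] := cD _ hc.
split; last first.
  by rewrite /parity count_map (eq_count (a2 := nth false t)) // eD.
exists (nth x0 s c.1), [seq (nth false t k.1, nth x0 s k.2) | k <- c.2].
split; last by rewrite nedge_walk.
rewrite /closed_walk.
have -> : map snd [seq (nth false t k.1, nth x0 s k.2) | k <- c.2] =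
          map (nth x0 s) (map snd c.2) by rewrite -!map_comp.
rewrite size_map h1 last_map hl eqxx /=.
rewrite map_inj_in_uniq // => i j /ha hi /ha hj /eqP.
by rewrite nth_uniq // => /eqP.
Qed.

End Concrete.

(** Only the unordered pairs of [L] have to follow the order of [E]; its signs are the signature for
    which a decomposition is picked from [Ds] and carried along the injective numbering [s]. *)
Lemma dec_covers (V : finType) (x0 : V) s E Ds (L : seq ({set V} * bool)) :
  uniq s -> covers (size s) E Ds ->
  map fst L = [seq [set nth x0 s e.1; nth x0 s e.2] | e <- E] ->
  ~~ parity L -> dec L.
Proof.
move=> us cov eL pL.
have sL : size L = size E by rewrite -(size_map fst L) eL size_map.
have -> : L = map (nedge x0 s E (map snd L)) (iota 0 (size E)).
  apply: (@eq_from_nth _ (set0, false)); first by rewrite size_map size_iota.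
  move=> i; rewrite sL => hi; rewrite (nth_map 0) ?size_iota // nth_iota // add0n /nedge.
  rewrite [LHS]surjective_pairing -(nth_map _ set0 fst) ?sL //.
  by rewrite -(nth_map _ false snd) ?sL // eL (nth_map (0, 0)).
apply: covers_dec us _ cov _; first by rewrite size_map.
by rewrite count_map.
Qed.

(* Vertices: 0 and 1 are the ends y and w of a path, 2, 3, 4 are joined to both;
   the path of [fan]i meets the first i of the latter, in this order. *)
Definition fan0 : seq (nat * nat) :=
  [:: (0, 1); (0, 2); (0, 3); (0, 4); (1, 2); (1, 3); (1, 4)].
(** The triangle 0 1 i is even if the two signs at i add up to that of the edge 01. The three such
    sums add up to this sign, so some i qualifies, and then the 4-cycle through the other two
    vertices is even as well. *)
Definition fan0_decs : seq (seq (nat * seq (nat * nat))) := [::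
  [:: (0, [:: (0, 1); (4, 2); (1, 0)]);
      (0, [:: (2, 3); (5, 1); (6, 4); (3, 0)])];
  [:: (0, [:: (0, 1); (5, 3); (2, 0)]);
      (0, [:: (1, 2); (4, 1); (6, 4); (3, 0)])];
  [:: (0, [:: (0, 1); (6, 4); (3, 0)]);
      (0, [:: (1, 2); (4, 1); (5, 3); (2, 0)])]].

Definition fan1 : seq (nat * nat) :=
  [:: (0, 2); (2, 1); (0, 2); (0, 3); (0, 4); (1, 2); (1, 3); (1, 4)].
(** When the path meets a spoke end, its first and last pieces become parallel to spokes, hence the
    cycles of length 2. *)
Definition fan1_decs : seq (seq (nat * seq (nat * nat))) := [::
  [:: (0, [:: (0, 2); (1, 1); (6, 3); (3, 0)]);
      (0, [:: (2, 2); (5, 1); (7, 4); (4, 0)])];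
  [:: (0, [:: (0, 2); (1, 1); (7, 4); (4, 0)]);
      (0, [:: (2, 2); (5, 1); (6, 3); (3, 0)])];
  [:: (0, [:: (0, 2); (2, 0)]);
      (2, [:: (1, 1); (5, 2)]);
      (0, [:: (3, 3); (6, 1); (7, 4); (4, 0)])];
  [:: (0, [:: (0, 2); (5, 1); (6, 3); (3, 0)]);
      (2, [:: (1, 1); (7, 4); (4, 0); (2, 2)])]].

Definition fan2 : seq (nat * nat) :=
  [:: (0, 2); (2, 3); (3, 1); (0, 2); (0, 3); (0, 4); (1, 2); (1, 3); (1, 4)].
Definition fan2_decs : seq (seq (nat * seq (nat * nat))) := [::
  [:: (0, [:: (0, 2); (6, 1); (2, 3); (4, 0)]);
      (2, [:: (1, 3); (7, 1); (8, 4); (5, 0); (3, 2)])];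
  [:: (0, [:: (0, 2); (6, 1); (7, 3); (4, 0)]);
      (2, [:: (1, 3); (2, 1); (8, 4); (5, 0); (3, 2)])];
  [:: (0, [:: (0, 2); (3, 0)]);
      (2, [:: (1, 3); (4, 0); (5, 4); (8, 1); (6, 2)]);
      (3, [:: (2, 1); (7, 3)])];
  [:: (0, [:: (0, 2); (1, 3); (2, 1); (8, 4); (5, 0)]);
      (0, [:: (3, 2); (6, 1); (7, 3); (4, 0)])]].

Definition fan3 : seq (nat * nat) :=
  [:: (0, 2); (2, 3); (3, 4); (4, 1); (0, 2); (0, 3); (0, 4); (1, 2); (1, 3); (1, 4)].
Definition fan3_decs : seq (seq (nat * seq (nat * nat))) := [::
  [:: (0, [:: (0, 2); (1, 3); (8, 1); (3, 4); (6, 0)]);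
      (3, [:: (2, 4); (9, 1); (7, 2); (4, 0); (5, 3)])];
  [:: (0, [:: (0, 2); (1, 3); (8, 1); (9, 4); (6, 0)]);
      (3, [:: (2, 4); (3, 1); (7, 2); (4, 0); (5, 3)])];
  [:: (0, [:: (0, 2); (1, 3); (5, 0)]);
      (3, [:: (2, 4); (6, 0); (4, 2); (7, 1); (8, 3)]);
      (4, [:: (3, 1); (9, 4)])];
  [:: (0, [:: (0, 2); (4, 0)]);
      (2, [:: (1, 3); (2, 4); (3, 1); (7, 2)]);
      (0, [:: (5, 3); (8, 1); (9, 4); (6, 0)])];
  [:: (0, [:: (0, 2); (7, 1); (3, 4); (2, 3); (5, 0)]);
      (2, [:: (1, 3); (8, 1); (9, 4); (6, 0); (4, 2)])]].

Lemma fan0_covers : covers 5 fan0 fan0_decs. Proof. by vm_compute. Qed.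
Lemma fan1_covers : covers 5 fan1 fan1_decs. Proof. by vm_compute. Qed.
Lemma fan2_covers : covers 5 fan2 fan2_decs. Proof. by vm_compute. Qed.
Lemma fan3_covers : covers 5 fan3 fan3_decs. Proof. by vm_compute. Qed.

(** * Two vertices joined to an even set *)

Section Fan.

Variable V : finType.
Implicit Types (y w : V) (N : seq V) (b d : V -> bool).

Definition spokes y b N := [seq ([set y; n], b n) | n <- N].

Lemma spokes_perm y b N N' : perm_eq N N' -> perm_eq (spokes y b N) (spokes y b N').
Proof. exact: perm_map. Qed.

Lemma parity_spokes y w b d N :
  parity (spokes y b N ++ spokes w d N) = odd (count (fun n => b n (+) d n) N).
Proof.
rewrite parity_cat /parity !count_map; elim: N => //= n N IH.
rewrite !oddD -IH; case: (b n); case: (d n);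
  by case: (odd (count _ N)); case: (odd (count _ N)).
Qed.

(** Any two [n], [n'] in [N] close a 4-cycle y n w n', which is even because both halves between [y]
    and [w] have parity [r]. *)
Lemma dec_theta_const y w b d N r : y != w -> uniq N -> y \notin N -> w \notin N ->
  ~~ odd (size N) -> {in N, forall n, b n (+) d n = r} ->
  dec (spokes y b N ++ spokes w d N).
Proof.
move=> yw; have [k] := ubnP (size N); elim: k N => // k IH [|n [|n' N]] //=.
  by move=> *; apply: dec_nil.
rewrite ltnS !inE !negb_or negbK => hk /andP[/andP[nn' nN] /andP[n'N uN]].
move=> /and3P[yn yn' yN] /and3P[wn wn' wN] sN hr.
have hn : b n (+) d n = r by apply: hr; rewrite inE eqxx.
have hn' : b n' (+) d n' = r by apply: hr; rewrite !inE eqxx orbT.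
apply: (@dec_perm _ (([:: ([set y; n], b n); ([set n; w], d n); ([set w; n'], d n');
   ([set n'; y], b n')]) ++ (spokes y b N ++ spokes w d N))).
  rewrite [[set n; w]]setUC [[set n'; y]]setUC.
  by apply/permP => P /=; rewrite !count_cat /= -/(spokes y b N) -/(spokes w d N); ring.
apply: dec_cat; last first.
  by apply: IH => // [|z zN]; [apply: ltn_trans hk | apply: hr; rewrite !inE zN !orbT].
apply: dec_cycle; last first.
  rewrite !parity_cons /parity /=; move: hn hn'.
  by case: (b n) (d n) (b n') (d n') => [] [] [] [] /= <-.
exists y, [:: (b n, n); (d n, w); (d n', n'); (b n', y)]; split => //.
rewrite /closed_walk /= eqxx /= !inE !negb_or (eq_sym n w) wn nn' (eq_sym n y) yn wn'.
by rewrite (eq_sym w y) yw (eq_sym n' y) yn'.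
Qed.

(** [N] is split by the parity of the path y n w. The total being even, the odd class has even size,
    and so has the other; each is then treated with constant parity. *)
Lemma dec_theta y w b d N : y != w -> uniq N -> y \notin N -> w \notin N ->
  ~~ odd (size N) -> ~~ parity (spokes y b N ++ spokes w d N) ->
  dec (spokes y b N ++ spokes w d N).
Proof.
move=> yw uN yN wN sN; rewrite parity_spokes => pN.
set a := fun n => b n (+) d n in pN.
have hp : perm_eq (filter a N ++ filter (predC a) N) N by rewrite perm_filterC.
have sub (f : pred V) z : z \notin N -> z \notin filter f N.
  by rewrite mem_filter => /negbTE->; rewrite andbF.
apply: (@dec_perm _ ((spokes y b (filter a N) ++ spokes w d (filter a N)) ++
   (spokes y b (filter (predC a) N) ++ spokes w d (filter (predC a) N)))).
  rewrite perm_catACA /spokes -!map_cat; apply: perm_cat; exact: perm_map.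
have st : ~~ odd (size (filter a N)) by rewrite size_filter.
apply: dec_cat; [apply: (@dec_theta_const _ _ _ _ _ true) => //
                |apply: (@dec_theta_const _ _ _ _ _ false) => //];
  rewrite ?filter_uniq ?sub //.
- by move=> n; rewrite mem_filter => /andP[].
- by move: sN; rewrite -(perm_size hp) size_cat oddD (negbTE st).
- by move=> n; rewrite mem_filter => /andP[/negbTE].
Qed.

End Fan.

(** * Fans with an arbitrary path between their two centres *)

Section FanPath.

Variable V : finType.
Implicit Types (y w : V) (N : seq V) (b d : V -> bool).

(** The elements where [a] has value [r] are odd in number, the others even. Three of the first kind
    sum to [r], and so do one of the first and two of the second. *)
Lemma fan_triple (a : pred V) N (r : bool) :
  odd (size N) -> 2 < size N -> odd (count a N) = r ->
  exists T N', [/\ perm_eq N (T ++ N'), size T = 3 & odd (count a T) = r].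
Proof.
move=> oN sN cN; set P := fun n => a n == r.
have hp : perm_eq N (filter P N ++ filter (predC P) N).
  by rewrite perm_sym perm_filterC.
have cP : odd (size (filter P N)).
  rewrite size_filter; case: r @P cN {hp} => P cN.
    by rewrite (eq_count (a2 := a)) // => n; rewrite /P eqb_id.
  rewrite (eq_count (a2 := predC a)); last by move=> n; rewrite /P /=; case: (a n).
  by move: oN; rewrite -(count_predC a) oddD cN.
have PS n : n \in filter P N -> a n = r by rewrite mem_filter => /andP[/eqP].
have PU n : n \in filter (predC P) N -> a n = ~~ r.
  by rewrite mem_filter /= /P => /andP[]; case: (a n); case: r {cN P hp cP PS}.
move: hp (perm_size hp) cP PS PU; rewrite size_cat.
move: (filter P N) (filter (predC P) N) => S U hp hs cS PS PU.
have cU : ~~ odd (size U) by move: oN; rewrite hs oddD cS /=.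
case: U hp hs PU cU => [|u1 [|u2 U]] hp hs PU cU //.
  case: S hp hs PS cS => [|s1 [|s2 [|s3 S]]] hp hs PS cS //; try by rewrite hs in sN.
  exists [:: s1; s2; s3], S; split => //; first by rewrite cats0 in hp.
  by rewrite /= (PS s1) ?(PS s2) ?(PS s3) ?inE ?eqxx ?orbT //; case: (r).
case: S hp hs PS cS => [|s1 S] hp hs PS cS //.
exists [:: s1; u1; u2], (S ++ U); split => //.
  by apply: perm_trans hp _; apply/permP => Q; rewrite /= !count_cat /=; ring.
by rewrite /= (PS s1) ?(PU u1) ?(PU u2) ?inE ?eqxx ?orbT //; case: (r).
Qed.

(** A vertex of the path outside [y], [w] and [N] lies on no spoke, so it has degree 2 and is
    suppressed. Listing [N] with the vertices met by the path first, in their order on it, turns the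
    graph into one of the four fans. *)
Lemma dec_fan3 y w q N b d : upath y q w -> y != w ->
  uniq N -> y \notin N -> w \notin N -> size N = 3 ->
  ~~ parity (wedges y q ++ (spokes y b N ++ spokes w d N)) ->
  dec (wedges y q ++ (spokes y b N ++ spokes w d N)).
Proof.
move=> /andP[/eqP lq uq] yw uN yN wN sN; set L := spokes y b N ++ _ => pL.
set D := fun v => v \in [:: y, w & N].
have [||//|m hm|q' [hq' pq' hdec]] := @dec_suppress_path _ D y q L.
- by rewrite /D inE eqxx.
- by rewrite lq /D !inE eqxx orbT.
- move: hm; rewrite /D !inE !negb_or => /and3P[my mw mN].
  rewrite /fresh /spokes all_cat; apply/andP; split; apply/allP => e /mapP[n nN ->] /=;
  by rewrite !inE negb_or ?my ?mw; apply: contraNneq mN => ->.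
apply/hdec.
have {pL} : ~~ parity (wedges y q' ++ L) by rewrite parity_cat pq' -parity_cat.
have [k0 ek0] : exists k0, map snd q = rcons k0 w.
  case/lastP: (map snd q) lq => [|k0 z]; first by move=> /= e; rewrite e eqxx in yw.
  by rewrite last_rcons => ->; exists k0.
move: uq; rewrite ek0 cons_uniq rcons_uniq mem_rcons inE negb_or.
move=> /andP[/andP[_ yk0] /andP[wk0 uk0]].
set k := filter D k0.
have {hq'} hq' : map snd q' = rcons k w by rewrite hq' ek0 filter_rcons {1}/D !inE eqxx orbT.
have uk : uniq k by rewrite filter_uniq.
have sk : {subset k <= N}.
  move=> z; rewrite mem_filter /D !inE => /andP[/or3P[/eqP->|/eqP->|//]].
    by rewrite (negbTE yk0).
  by rewrite (negbTE wk0).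
have [r hr] : exists r, perm_eq N (k ++ r).
  exists (filter (fun z => z \notin k) N); rewrite uniq_perm //.
    rewrite cat_uniq uk filter_uniq // andbT /=; apply/hasPn => z.
    by rewrite mem_filter => /andP[].
  move=> z; rewrite mem_cat mem_filter; case: (boolP (z \in k)) => //= /sk.
  by move=> ->.
have hL : perm_eq L (spokes y b (k ++ r) ++ spokes w d (k ++ r)).
  by apply: perm_cat; apply: spokes_perm.
have := perm_cat (perm_refl (wedges y q')) hL.
move=> hL2; rewrite (parity_perm hL2) => pL.
apply: (dec_perm (L := wedges y q' ++ (spokes y b (k ++ r) ++ spokes w d (k ++ r)))).
  by rewrite perm_sym.
have : uniq [:: y, w & k ++ r].
  by rewrite /= inE negb_or yw -!(perm_mem hr) yN wN -(perm_uniq hr).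
move: (perm_size hr); rewrite sN.
clearbody k; clear -hq' pL.
(* The length of [k], at most 3, selects the fan; the suppressed path runs through [k] and then to
   [w], so it has one edge more than [k] has vertices. *)
case: k hq' pL => [|k1 [|k2 [|k3 [|k4 k]]]] hq' pL //=;
 case: r pL => [|r1 [|r2 [|r3 [|r4 r]]]] pL // _ us;
 move: hq' pL; do 6?[case: q' => [|[? ?] q'] //=]; case=> *; subst.
- exact: (dec_covers (x0 := y) (s := [:: y; w; r1; r2; r3]) us fan0_covers).
- exact: (dec_covers (x0 := y) (s := [:: y; w; k1; r1; r2]) us fan1_covers).
- exact: (dec_covers (x0 := y) (s := [:: y; w; k1; k2; r1]) us fan2_covers).
- exact: (dec_covers (x0 := y) (s := [:: y; w; k1; k2; k3]) us fan3_covers).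
Qed.

(** Three vertices [T] absorb the parity of the path, and the rest of [N] is even in size and total
    sign. The path may also pass through this rest: there its vertices are suppressed like any
    others, the spokes at them being decomposed apart from it. *)
Lemma dec_fan y w q N b d : upath y q w -> y != w ->
  uniq N -> y \notin N -> w \notin N -> odd (size N) -> 2 < size N ->
  ~~ parity (wedges y q ++ (spokes y b N ++ spokes w d N)) ->
  dec (wedges y q ++ (spokes y b N ++ spokes w d N)).
Proof.
move=> hq yw uN yN wN oN sN pL.
set a := fun n => b n (+) d n.
have ca : odd (count a N) = parity (wedges y q).
  move: pL; rewrite parity_cat parity_spokes -/a.
  by case: parity; case: odd.
have [T [N' [hN sT cT]]] := fan_triple oN sN ca.
have : uniq (T ++ N') by rewrite -(perm_uniq hN).
rewrite cat_uniq => /and3P[uT _ uN'].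
move: yN wN; rewrite !(perm_mem hN) !mem_cat !negb_or => /andP[yT yN'] /andP[wT wN'].
have hL : perm_eq (wedges y q ++ (spokes y b N ++ spokes w d N))
   ((wedges y q ++ (spokes y b T ++ spokes w d T)) ++ (spokes y b N' ++ spokes w d N')).
  rewrite -catA perm_cat2l perm_sym perm_catACA perm_sym.
  by apply: perm_cat; rewrite /spokes -map_cat; apply: perm_map.
have pT : ~~ parity (wedges y q ++ (spokes y b T ++ spokes w d T)).
  by rewrite parity_cat parity_spokes -/a cT addbb.
rewrite (parity_perm hL) parity_cat (negbTE pT) /= in pL.
rewrite perm_sym in hL; apply: dec_perm hL (dec_cat (dec_fan3 hq yw uT yT wT sT pT) _).
apply: dec_theta => //.
by move: oN; rewrite (perm_size hN) size_cat oddD sT.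
Qed.

End FanPath.

(** * Leaves of signed multigraphs without even cycles *)

Section Degrees.

Variable V : finType.
Implicit Types (x y z v w : V) (p q : seq (bool * V)) (c L R : seq ({set V} * bool)).

Definition mdeg v L := count (fun e : {set V} * bool => v \in e.1) L.

Definition wf (X : seq V) L := forall e, e \in L ->
  exists x y, [/\ x != y, x \in X, y \in X & e.1 = [set x; y]].

Lemma mdeg_cat v L1 L2 : mdeg v (L1 ++ L2) = mdeg v L1 + mdeg v L2.
Proof. exact: count_cat. Qed.

Lemma mdeg_perm v L1 L2 : perm_eq L1 L2 -> mdeg v L1 = mdeg v L2.
Proof. by move/permP; apply. Qed.

Lemma mdeg_fresh v L : fresh v L = (mdeg v L == 0).
Proof. by rewrite eqn0Ngt -has_count -all_predC. Qed.

Lemma wf_sub X L L' : {subset L' <= L} -> wf X L -> wf X L'.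
Proof. by move=> h hw e /h /hw. Qed.

Lemma upath_mdeg x p v : uniq (x :: map snd p) ->
  odd (mdeg v (wedges x p)) = (v == x) (+) (v == last x (map snd p)).
Proof.
elim: p x => [|[s u] p IH] x; first by rewrite addbb.
rewrite /= inE negb_or => /andP[/andP[xu _] hu].
rewrite oddD -/(mdeg _ _) IH // !inE addbA; congr (_ (+) _).
by have [->|] := eqVneq v x; [rewrite (negbTE xu) | case: (v == u)].
Qed.

Lemma cycle_mdeg c v : is_cycle c -> ~~ odd (mdeg v c).
Proof.
move=> [x [p [/and3P[hs /eqP hl hu] /mdeg_perm ->]]].
case: p hs hl hu => [|[s u] p] //= hs hl hu.
rewrite oddD -/(mdeg _ _) upath_mdeg // hl !inE.
have xu : x != u.
  apply: contraTneq hu => e; case: p hs hl => // a p _ hl.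
  by rewrite -e -[in x \in _]hl /= mem_last.
by have [->|] := eqVneq v x; [rewrite (negbTE xu) | case: (v == u)].
Qed.

(** With all signs even this shows that a strongly decomposable graph has even degrees. *)
Lemma dec_mdeg v L : dec L -> ~~ odd (mdeg v L).
Proof.
move=> [cs [h /mdeg_perm <-]]; elim: cs h => [|c cs IH] h //=.
rewrite mdeg_cat oddD negb_add; have [hc _] := h c (mem_head _ _).
rewrite (negbTE (cycle_mdeg _ hc)) (negbTE (IH _)) // => c' hc'.
by apply: h; rewrite inE hc' orbT.
Qed.

Definition has_even_cycle L :=
  exists c L', [/\ is_cycle c, ~~ parity c & perm_eq L (c ++ L')].

Lemma even_cycle_in c L R : is_cycle c -> ~~ parity c -> perm_eq L (c ++ R) ->
  has_even_cycle L.
Proof. by move=> *; exists c, R. Qed.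

Lemma upath_wedges_uniq x p : uniq (x :: map snd p) -> uniq (wedges x p).
Proof.
elim: p x => [|[s u] p IH] x //= /andP[hx hu]; rewrite IH // andbT.
apply: contra hx => /wedges_sub; apply.
by rewrite !inE eqxx.
Qed.

Lemma perm_sub_cat (T : eqType) (s1 s2 : seq T) : uniq s1 -> {subset s1 <= s2} ->
  exists s3, perm_eq s2 (s1 ++ s3).
Proof.
elim: s1 s2 => [|a s1 IH] s2 /=; first by exists s2.
move=> /andP[ha hu] hs.
have has2 : a \in s2 by apply: hs; rewrite mem_head.
have [|s3 h3] := IH (rem a s2) hu.
  move=> b hb; have : b \in s2 by apply: hs; rewrite inE hb orbT.
  rewrite (perm_mem (perm_to_rem has2)) inE => /orP[/eqP e|//].
  by rewrite -e hb in ha.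
by exists s3; apply: perm_trans (perm_to_rem has2) _; rewrite perm_cons.
Qed.

Lemma split_at a x p : a \in x :: map snd p ->
  exists m1 m2, p = m1 ++ m2 /\ last x (map snd m1) = a.
Proof.
elim: p x => [|[s u] p IH] x /=; rewrite inE; first by move/eqP->; exists [::], [::].
case/orP => [/eqP->|]; first by exists [::], ((s, u) :: p).
by move=> /IH[m1 [m2 [-> <-]]]; exists ((s, u) :: m1), m2.
Qed.

(* Three edges from y into a path avoiding y yield a theta, whose three cycles
   have even total parity. *)
Lemma even_cycle_theta x y m1 m2 m3 s1 s2 s3 a2 a3 L R :
  uniq (y :: x :: map snd (m1 ++ (m2 ++ m3))) ->
  last x (map snd m1) = a2 -> last a2 (map snd m2) = a3 ->
  perm_eq L ([:: ([set y; x], s1); ([set y; a2], s2); ([set y; a3], s3)] ++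
     (wedges x (m1 ++ (m2 ++ m3)) ++ R)) ->
  has_even_cycle L.
Proof.
move=> hu h2 h3; rewrite !wedges_cat h2 h3 => hL.
have {hu} : [/\ uniq (x :: map snd m1), uniq (a2 :: map snd m2),
   uniq (x :: (map snd m1 ++ map snd m2)) & y \notin x :: map snd m1 ++ map snd m2].
  move: hu; rewrite !map_cat catA.
  rewrite -[x :: (_ ++ _) ++ _]/((x :: (map snd m1 ++ map snd m2)) ++ map snd m3).
  rewrite -cat1s !cat_uniq => /and3P[_ hy /and3P[hu _ _]].
  have hyx : y \notin x :: map snd m1 ++ map snd m2.
    apply: contra hy => hy; apply/hasP; exists y; last by rewrite inE.
    by rewrite mem_cat hy.
  split => //; move: hu; rewrite -cat_cons cat_uniq => /and3P[hu1 hd hu2] //.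
  rewrite /= hu2 andbT; apply/negP => ha; case/negP: hd; apply/hasP; exists a2 => //.
  by rewrite -h2 mem_last.
case=> u1 u2 u12; rewrite inE mem_cat !negb_or => /and3P[yx ym1 ym2].
have ya2 : y != a2.
  have := mem_last x (map snd m1); rewrite h2 inE => /orP[/eqP->//|h].
  by apply: contraNneq ym1 => ->.
(* Each of the three edges at [y], and each of [m1] and [m2], lies on exactly two of [c1], [c2],
   [c3]. If [m1] or [m2] is empty, two edges at [y] are parallel and one cycle has length 2. *)
set c1 := ([set y; x], s1) :: wedges x m1 ++ [:: ([set y; a2], s2)].
set c2 := ([set y; x], s1) :: (wedges x m1 ++ wedges a2 m2) ++ [:: ([set y; a3], s3)].
set c3 := ([set y; a2], s2) :: wedges a2 m2 ++ [:: ([set y; a3], s3)].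
have hc1 : is_cycle c1.
  exists y, ((s1, x) :: m1 ++ [:: (s2, y)]); split; last first.
    by rewrite /= wedges_cat h2 /= (setUC [set a2]).
  rewrite /closed_walk /= size_cat addn1 /= map_cat last_cat /= eqxx cats1.
  rewrite mem_rcons rcons_uniq inE negb_or (eq_sym x) yx ym1 /=.
  by move: u1 => /= /andP[-> ->].
have hc2 : is_cycle c2.
  exists y, ((s1, x) :: (m1 ++ m2) ++ [:: (s3, y)]); split; last first.
    by rewrite /= !wedges_cat map_cat last_cat h2 h3 /= (setUC [set a3]).
  rewrite /closed_walk /= size_cat addn1 /= map_cat last_cat /= eqxx cats1.
  rewrite mem_rcons rcons_uniq inE negb_or (eq_sym x) yx map_cat !mem_cat !negb_or ym1 ym2 /=.
  by move: u12; rewrite /= mem_cat negb_or => /andP[-> ->].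
have hc3 : is_cycle c3.
  exists y, ((s2, a2) :: m2 ++ [:: (s3, y)]); split; last first.
    by rewrite /= wedges_cat h3 /= (setUC [set a3]).
  rewrite /closed_walk /= size_cat addn1 /= map_cat last_cat /= eqxx cats1.
  rewrite mem_rcons rcons_uniq inE negb_or (eq_sym a2) ya2 ym2 /=.
  by move: u2 => /= /andP[-> ->].
have [p1|p1] := boolP (parity c1); last first.
  apply: (even_cycle_in (R := ([set y; a3], s3) :: wedges a2 m2 ++ (wedges a3 m3 ++ R)) hc1 p1).
  by apply: perm_trans hL _; apply/permP => P; rewrite /= !count_cat /= !count_cat; ring.
have [p2|p2] := boolP (parity c2); last first.
  apply: (even_cycle_in (R := ([set y; a2], s2) :: (wedges a3 m3 ++ R)) hc2 p2).
  by apply: perm_trans hL _; apply/permP => P; rewrite /= !count_cat /= !count_cat; ring.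
apply: (even_cycle_in (R := ([set y; x], s1) :: wedges x m1 ++ (wedges a3 m3 ++ R)) hc3 _).
  move: p1 p2; rewrite !parity_cons !parity_cat !parity_cons /=.
  by case: (parity (wedges x m1)); case: (parity (wedges a2 m2));
    case: (s1); case: (s2); case: (s3).
by apply: perm_trans hL _; apply/permP => P; rewrite /= !count_cat /= !count_cat; ring.
Qed.

Lemma wf_edge X L e v : wf X L -> e \in L -> v \in e.1 ->
  exists u, [/\ v != u, u \in X & e = ([set v; u], e.2)].
Proof.
move=> hw he; have [a [b [ab aX bX eab]]] := hw e he.
rewrite eab !inE => /orP[]/eqP->; first by exists b; rewrite -eab -surjective_pairing.
by exists a; rewrite eq_sym setUC -eab -surjective_pairing.
Qed.

End Degrees.

(** * Leaves as ends of maximal paths *)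

Section Leaves.

Variable V : finType.
Implicit Types (x y z v w t : V) (p q : seq (bool * V)) (X : seq V).
Implicit Types (c L R : seq ({set V} * bool)).

Lemma fresh_cat v L1 L2 : fresh v (L1 ++ L2) = fresh v L1 && fresh v L2.
Proof. exact: all_cat. Qed.

Lemma fresh_cons v e L : fresh v (e :: L) = (v \notin e.1) && fresh v L.
Proof. by []. Qed.

Lemma mdeg_cons v e L : mdeg v (e :: L) = (v \in e.1) + mdeg v L.
Proof. by []. Qed.

Lemma nfreshP v L : ~~ fresh v L -> exists2 e, e \in L & v \in e.1.
Proof. by rewrite /fresh -has_predC => /hasP[e he /= hv]; exists e; rewrite // -[_ \in _]negbK. Qed.

Lemma odd_mdeg_nfresh v L : odd (mdeg v L) -> ~~ fresh v L.
Proof. by rewrite mdeg_fresh; apply: contraTneq => ->. Qed.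

(** The degree of [y] is odd, so one further edge at [y] implies a second one. By maximality both
    return to the path, which supplies the three edges of a theta. *)
Lemma leaf_of_maximal X L y x s p : wf X L -> uniq (y :: x :: map snd p) ->
  {subset wedges y ((s, x) :: p) <= L} -> odd (mdeg y L) ->
  (forall e, e \in L -> y \in e.1 -> {subset e.1 <= y :: x :: map snd p}) ->
  has_even_cycle L \/ exists2 L', perm_eq L (([set y; x], s) :: L') & fresh y L'.
Proof.
move=> hw hu hs hd hmax.
have hu' := hu; move: hu' => /= /andP[yxp /andP[xp up]].
have he1 : ([set y; x], s) \in L by apply: hs; rewrite /= mem_head.
have hL1 := perm_to_rem he1; set L1 := rem _ L in hL1.
have [fy|/nfreshP[e2 he2 ye2]] := boolP (fresh y L1); first by right; exists L1.
have hL2 := perm_to_rem he2; set L2 := rem _ L1 in hL2.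
have hL12 : perm_eq L (([set y; x], s) :: e2 :: L2).
  by apply: perm_trans hL1 _; rewrite perm_cons.
have /odd_mdeg_nfresh/nfreshP[e3 he3 ye3] : odd (mdeg y L2).
  by move: hd; rewrite (mdeg_perm _ hL12) !mdeg_cons ye2 !inE eqxx /= negbK.
have hL3 := perm_to_rem he3; set L3 := rem _ L2 in hL3.
have hL123 : perm_eq L ([:: ([set y; x], s); e2; e3] ++ L3).
  by apply: perm_trans hL12 _; rewrite /= !perm_cons.
have sub e : e \in L2 -> e \in L by rewrite (perm_mem hL12) !inE => ->; rewrite !orbT.
have he2L : e2 \in L by rewrite (perm_mem hL12) !inE eqxx orbT.
have [a2 [ya2 _ e2E]] := wf_edge hw he2L ye2.
have [a3 [ya3 _ e3E]] := wf_edge hw (sub _ he3) ye3.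
have ha2 : a2 \in x :: map snd p.
  have := hmax _ he2L ye2 a2; rewrite e2E !inE eqxx orbT eq_sym (negbTE ya2); exact.
have ha3 : a3 \in x :: map snd p.
  have := hmax _ (sub _ he3) ye3 a3; rewrite e3E !inE eqxx orbT eq_sym (negbTE ya3); exact.
(* The edges of the path beyond [x] avoid [y], so they are none of the three edges at [y] and can be
   drawn from what is left of [L]. *)
have [|e heW|L4 hL4] := @perm_sub_cat _ (wedges x p) L3.
- by apply: upath_wedges_uniq; rewrite /= xp.
- have ye : y \notin e.1 by apply: contra yxp => /(wedges_sub heW).
  have : e \in L by apply: hs; rewrite /= inE heW orbT.
  rewrite (perm_mem hL123) !inE => /or4P[/eqP ee|/eqP ee|/eqP ee|//].
  + by rewrite ee !inE eqxx in ye.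
  + by rewrite ee ye2 in ye.
  + by rewrite ee ye3 in ye.
have hL : perm_eq L ([:: ([set y; x], s); ([set y; a2], e2.2); ([set y; a3], e3.2)] ++
   (wedges x p ++ L4)).
  by rewrite -e2E -e3E; apply: perm_trans hL123 _; rewrite /= !perm_cons.
left; have [m1 [m [ep h2]]] := split_at ha2.
(* The theta lemma wants the two return points in path order, so the two edges are exchanged if [a3]
   comes before [a2]. *)
have := ha3; rewrite ep map_cat -cat_cons mem_cat => /orP[h31|h32].
  have [n1 [n2 [em1 h3]]] := split_at h31.
  have h2' : last a3 (map snd n2) = a2 by rewrite -h2 em1 map_cat last_cat h3.
  rewrite ep em1 -catA in hu hL.
  apply: (even_cycle_theta (s1 := s) (s2 := e3.2) (s3 := e2.2) (R := L4) hu h3 h2').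
  by apply: perm_trans hL _; apply/permP => P; rewrite /=; ring.
have {h32} h32 : a3 \in a2 :: map snd m by rewrite inE h32 orbT.
have [m2 [m3 [em h3]]] := split_at h32.
by rewrite ep em in hu hL; apply: (even_cycle_theta hu h2 h3 hL).
Qed.

(** A path is started along an edge at [t] and extended only at its other end, so the leaf found is
    not [t] and the degree of [t] may be even. This permits a new search after pendant edges at [t]
    have been set aside: their leaves are then isolated, and other degrees are unchanged. *)
Lemma leaf_exists X L t : wf X L ->
  (forall v, v != t -> fresh v L \/ odd (mdeg v L)) -> ~~ fresh t L ->
  has_even_cycle L \/ exists y x s L',
    [/\ y != t, perm_eq L (([set y; x], s) :: L') & fresh y L'].
Proof.
move=> hw hd /nfreshP[e he te].
have [u [tu _ eE]] := wf_edge hw he te.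
suff main k y x s p : uniq (y :: x :: map snd p) -> last x (map snd p) = t ->
   {subset wedges y ((s, x) :: p) <= L} -> #|V| - size p <= k ->
   has_even_cycle L \/ exists y x s L',
    [/\ y != t, perm_eq L (([set y; x], s) :: L') & fresh y L'].
  apply: (main _ u t e.2 [::]); rewrite //= ?inE; first by rewrite eq_sym tu.
  by move=> e'; rewrite inE setUC -eE => /eqP->.
elim: k y x s p => [|k IH] y x s p hu hl hs hk.
  move: hk; rewrite leqn0 subn_eq0 => hk.
  have := max_card (mem (y :: x :: map snd p)); rewrite (card_uniqP hu) /= size_map.
  by move=> /ltnW; rewrite ltnNge hk.
have yt : y != t.
  move: hu; rewrite -hl => /= /andP[hy _]; apply: contraNneq hy => ->.
  exact: mem_last.
have yd : odd (mdeg y L).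
  have [fy|//] := hd y yt.
  have : ([set y; x], s) \in L by apply: hs; rewrite /= mem_head.
  by move/(freshP fy); rewrite !inE eqxx.
have [/hasP[e' he' /andP[ye' /subsetPn[z ze' zp]]]|hmax] := boolP (has (fun e' : {set V} * bool =>
    (y \in e'.1) && ~~ (e'.1 \subset [set z | z \in y :: x :: map snd p])) L).
  have [u' [yu' _ e'E]] := wf_edge hw he' ye'.
  have ez : z = u'.
    by move: ze' zp; rewrite e'E !inE => /orP[/eqP->|/eqP->//]; rewrite eqxx.
  subst z.
  apply: (IH u' y e'.2 ((s, x) :: p)) => //.
  - by rewrite cons_uniq hu andbT; move: zp; rewrite inE.
  - by move=> e'' /=; rewrite inE setUC -e'E => /orP[/eqP->//|/hs].
  - by rewrite /= subnS; case: (_ - _) hk.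
have hm e' : e' \in L -> y \in e'.1 -> {subset e'.1 <= y :: x :: map snd p}.
  move=> he' ye'; move/hasPn/(_ e' he'): hmax; rewrite ye' negbK => /subsetP h z /h.
  by rewrite inE.
have [ec|[L' hL' fy]] := leaf_of_maximal hw hu hs yd hm; first by left.
by right; exists y, x, s, L'.
Qed.

End Leaves.

(** * Induction on the substituted graph *)

Section Substitution.

Variables (V : finType) (B : seq ({set V} * bool)) (N : seq V) (sg : V -> V -> bool).
Hypotheses (uN : uniq N) (oN : odd (size N)) (sN : 2 < size N).
Implicit Types (x y z v w t : V) (p q : seq (bool * V)) (X : seq V).
Implicit Types (c L R : seq ({set V} * bool)).

(** These are the edges from the substituted vertices to [N], with [sg h n] as the sign of [hn]. In
    the total below, [B] is the part of the graph away from the substituted vertices and [L] lists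
    the edges among them. *)
Definition joins X := flatten [seq spokes h (sg h) N | h <- X].

Definition total_edges X L := B ++ (joins X ++ L).

(* A cycle through the virtual edge xz, minus this edge, extends by yx and zw to a
   path from w to y, to which [dec_fan] applies. *)
Lemma dec_leaves_distinct R y x s w z s' :
  y \notin N -> w \notin N -> y != w -> x != z -> y != x -> w != z -> y != z -> w != x ->
  fresh y R -> fresh w R ->
  (forall r, ~~ parity (([set x; z], r) :: R) -> dec (([set x; z], r) :: R)) ->
  let F := ([set y; x], s) :: ([set w; z], s') ::
     (spokes y (sg y) N ++ spokes w (sg w) N) ++ R in
  ~~ parity F -> dec F.
Proof.
move=> yN wN yw xz yx wz yz wx fy fw hR F pF.
(* The virtual edge takes the parity of [R] as its sign, so the two together are even. *)
have hd := hR (parity R); rewrite parity_cons addbb in hd.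
have [c [L' [hc pc ec hL' hperm]]] := dec_pick (hd isT) (mem_head _ _).
have [p hp cp] := cycle_rotate xz hc ec.
have zx : z != x by rewrite eq_sym.
have pn := upath_neq_nil zx hp.
have hpR : perm_eq R (wedges z p ++ L').
  by have := perm_trans hperm (perm_cat cp (perm_refl L')); rewrite /= perm_cons.
have fwed v : fresh v R -> v \notin z :: map snd p.
  by rewrite (fresh_perm _ hpR) fresh_cat => /andP[/fresh_wedges/(_ pn)].
have yp := fwed _ fy; have wp := fwed _ fw.
set q := (s', z) :: p ++ [:: (s, y)].
move: hp => /andP[/eqP lp up].
have hq : upath w q y.
  rewrite /upath /q /= map_cat last_cat /= eqxx cats1 /=.
  rewrite -/(uniq (w :: z :: rcons (map snd p) y)) -!rcons_cons rcons_uniq.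
  by rewrite cons_uniq up wp inE negb_or yw yp.
have wq : perm_eq (wedges w q) (([set y; x], s) :: ([set w; z], s') :: wedges z p).
  rewrite /q /= wedges_cat lp /= (setUC [set x]).
  by apply/permP => P; rewrite /= count_cat /=; ring.
clearbody q.
have hF : perm_eq F
   ((wedges w q ++ (spokes w (sg w) N ++ spokes y (sg y) N)) ++ L').
  apply/permP => P; rewrite /F /= !count_cat (permP wq) (permP hpR) /= count_cat; ring.
(* [L'] is decomposed, hence even, so the evenness of [F] passes to the path with its fan. *)
move: pF; rewrite (parity_perm hF) parity_cat (negbTE (dec_parity hL')) addbF => pF.
rewrite perm_sym in hF; apply: dec_perm hF (dec_cat _ hL').
by apply: dec_fan => //; rewrite eq_sym.
Qed.

(** The total sign at a leaf [y] whose edge inside H has sign [s], spokes included. *)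
Definition leaf_parity y s := s (+) odd (count (sg y) N).

(** Equal leaf parities make the path y x w even together with its fan, which therefore splits off
    without affecting [R]. *)
Lemma dec_leaves_common R y x s w s' :
  y \notin N -> w \notin N -> y != w -> y != x -> w != x ->
  leaf_parity y s = leaf_parity w s' -> dec R ->
  dec (([set y; x], s) :: ([set w; x], s') ::
     (spokes y (sg y) N ++ spokes w (sg w) N) ++ R).
Proof.
move=> yN wN yw yx wx hyw hR.
rewrite -2!cat_cons; apply: dec_cat hR.
rewrite [[set w; x]]setUC.
apply: (@dec_fan _ y w [:: (s, x); (s', w)]) => //.
  by rewrite /upath /= eqxx !inE negb_or yx yw eq_sym wx.
have ps h : parity (spokes h (sg h) N) = odd (count (sg h) N) by rewrite /parity count_map.
move: hyw; rewrite /leaf_parity /= !parity_cons parity_cat !ps /=.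
by case: s; case: s'; case: odd; case: odd.
Qed.

Variable X0 : pred V.
Hypothesis freshB : forall h, h \in X0 -> fresh h B /\ h \notin N.
(** A single edge [xy] in place of H gives a copy of G. Its sign is arbitrary, since the edge may be
    a virtual one. *)
Hypothesis base : forall x y s, x != y -> x \in X0 -> y \in X0 ->
  ~~ parity (total_edges [:: x; y] [:: ([set x; y], s)]) ->
  dec (total_edges [:: x; y] [:: ([set x; y], s)]).

(** The invariant of the induction. It does not ask for connectedness, which the removal of a cycle
    may destroy. *)
Record odd_graph X L : Prop := OddGraph {
  og_uniq : uniq X;
  og_nonempty : X != [::];
  og_sub : {subset X <= X0};
  og_wf : wf X L;
  og_odd : forall v, v \in X -> odd (mdeg v L) }.

Lemma fresh_joins v X : v \in X0 -> v \notin X -> fresh v (joins X).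
Proof.
move=> /freshB[_ vN] vX; apply/allP => e /flatten_mapP[h hX] /mapP[n nN ->] /=.
by rewrite !inE negb_or; apply/andP; split; [apply: contraNneq vX|apply: contraNneq vN] => ->.
Qed.

Lemma joins_perm X X' : perm_eq X X' -> perm_eq (joins X) (joins X').
Proof. by move=> h; apply: perm_flatten; apply: perm_map. Qed.

Lemma wf_fresh X L v : wf X L -> v \notin X -> fresh v L.
Proof.
move=> hw vX; apply/allP => e /hw[a [b [_ aX bX ->]]].
by rewrite !inE negb_or; apply/andP; split; apply: contraNneq vX => ->.
Qed.

(** With [y != z] and [w != x], each of [y] and [w] is on one edge only and is not the neighbour of
    the other, so [x] and [z] survive the deletion. *)
Lemma remove_leaves X L y x s w z s' L0 : odd_graph X L ->
  perm_eq L (([set y; x], s) :: ([set w; z], s') :: L0) -> fresh y L0 -> fresh w L0 ->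
  y != w -> y != z -> w != x ->
  exists X', [/\ perm_eq X [:: y, w & X'], x \in X', z \in X', wf X' L0
    & perm_eq (total_edges X L) (([set y; x], s) :: ([set w; z], s') ::
     (spokes y (sg y) N ++ spokes w (sg w) N) ++ total_edges X' L0)].
Proof.
move=> [uX _ sX hw hd] hL fy fw yw yz wx.
have [x1 [yx1 x1X [ee]]] : exists u, [/\ y != u, u \in X & ([set y; x], s) = ([set y; u], s)].
  by apply: (wf_edge (v := y) hw); rewrite ?(perm_mem hL) ?inE /= ?inE eqxx.
have [z1 [wz1 z1X [ee']]] : exists u, [/\ w != u, u \in X & ([set w; z], s') = ([set w; u], s')].
  by apply: (wf_edge (v := w) hw); rewrite ?(perm_mem hL) ?inE /= ?inE eqxx ?orbT.
have ? : x1 = x by case: (set2_eq ee) => [] [? ?]; congruence.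
have ? : z1 = z by case: (set2_eq ee') => [] [? ?]; congruence.
subst x1 z1.
have memX v : ~~ fresh v L -> v \in X by apply: contraR => /(wf_fresh hw).
have yX : y \in X by apply: memX; rewrite (fresh_perm _ hL) !fresh_cons !inE eqxx.
have wX : w \in X by apply: memX; rewrite (fresh_perm _ hL) !fresh_cons !inE eqxx andbF.
pose X' := filter (fun v => (v != y) && (v != w)) X.
have mX' v : (v \in X') = [&& v != y, v != w & v \in X] by rewrite mem_filter andbA.
have pX : perm_eq X [:: y, w & X'].
  apply: uniq_perm => //.
    by rewrite /= filter_uniq // inE !mX' !eqxx /= andbF orbF yw.
  move=> v; rewrite !inE mX'; have [->|_] := eqVneq v y; first by rewrite yX.
  by have [->|_] := eqVneq v w; first by rewrite wX.
exists X'; split => //.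
- by rewrite mX' eq_sym yx1 eq_sym wx.
- by rewrite mX' eq_sym yz eq_sym wz1.
- move=> e he; have heL : e \in L by rewrite (perm_mem hL) !inE he !orbT.
  have [a [b [ab aX bX eab]]] := hw e heL.
  have := freshP fy he; have := freshP fw he; rewrite eab !inE !negb_or.
  move=> /andP[wa wb] /andP[ya yb].
  by exists a, b; split; rewrite ?mX' ?aX ?bX ?andbT // ![_ == y]eq_sym ![_ == w]eq_sym
    ?ya ?yb ?wa ?wb.
- apply/permP => P; rewrite /total_edges !count_cat (permP (joins_perm pX)) (permP hL) /=.
  by rewrite /joins /= !count_cat; ring.
Qed.

Lemma dec_substitution X L : odd_graph X L -> ~~ parity (total_edges X L) -> dec (total_edges X L).
Proof.
(* Counting the edges inside H works as a measure because one virtual edge replaces two pendant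
   edges. *)
have [k] := ubnP (size L); elim: k X L => // k IH X L; rewrite ltnS => hk hog pL.
have [uX nX sX hw hd] := hog.
have hfresh L1 R v : perm_eq L (R ++ L1) -> v \notin X -> fresh v L1.
  by move=> hp /(wf_fresh hw); rewrite (fresh_perm _ hp) fresh_cat => /andP[].
(* A cycle has even degree at every vertex, so removing it keeps all degrees odd. [R] stands for
   pendant edges set aside before the cycle was found. *)
have even_cycle L1 R : perm_eq L (R ++ L1) -> has_even_cycle L1 -> dec (total_edges X L).
  move=> hp [c [L' [hc pc hL1]]].
  have hL : perm_eq L (c ++ (R ++ L')).
    by apply: perm_trans hp _; rewrite perm_sym perm_catCA perm_cat2l perm_sym.
  have hT : perm_eq (c ++ total_edges X (R ++ L')) (total_edges X L).
    by apply/permP => P; rewrite /total_edges !count_cat (permP hL) !count_cat; ring.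
  apply: (dec_perm hT (dec_cat (dec_cycle hc pc) _)).
  apply: IH.
  - rewrite (perm_size hL) size_cat in hk; apply: leq_trans hk.
    rewrite -[X in X < _]add0n ltn_add2r.
    case: hc => [x [p [/and3P[p1 _ _] /perm_size->]]].
    by case: (p) p1 => // [[]].
  - split => //.
      by apply: wf_sub hw => e he; rewrite (perm_mem hL) mem_cat he orbT.
    move=> v /hd; rewrite (mdeg_perm _ hL) mdeg_cat oddD.
    by rewrite (negbTE (cycle_mdeg _ hc)).
  by move: pL; rewrite -(parity_perm hT) parity_cat (negbTE pc).
have two_leaves y x s w z s' L0 : y != w -> y != z -> w != x ->
   perm_eq L (([set y; x], s) :: ([set w; z], s') :: L0) -> fresh y L0 -> fresh w L0 ->
   (x != z) || (leaf_parity y s == leaf_parity w s') -> dec (total_edges X L).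
  move=> yw yz wx hL fy fw hc.
  have [X' [hX xX' zX' hw' hT]] := remove_leaves hog hL fy fw yw yz wx.
  have : uniq [:: y, w & X'] by rewrite -(perm_uniq hX).
  rewrite /= inE negb_or => /and3P[/andP[_ yX'] wX' uX'].
  have yX : y \in X by rewrite (perm_mem hX) inE eqxx.
  have wX : w \in X by rewrite (perm_mem hX) !inE eqxx orbT.
  have [yB yN] := freshB (sX _ yX); have [wB wN] := freshB (sX _ wX).
  have yx : y != x by apply: contraNneq yX' => ->.
  have wz : w != z by apply: contraNneq wX' => ->.
  have nX' : X' != [::] by apply: contraTneq xX' => ->.
  have sX' : {subset X' <= X0}.
    by move=> v vX'; apply: sX; rewrite (perm_mem hX) !inE vX' !orbT.
  have hdv v : v \in X' -> odd ((v == x) + (v == z) + mdeg v L0).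
    move=> vX'; have := hd v; rewrite (perm_mem hX) !inE vX' !orbT => /(_ isT).
    rewrite (mdeg_perm _ hL) !mdeg_cons !inE addnA.
    have /negbTE-> : v != y by apply: contraTneq vX' => ->.
    by have /negbTE-> : v != w by apply: contraTneq vX' => ->.
  have fT v : v \in X -> v \notin X' -> fresh v L0 -> fresh v (total_edges X' L0).
    by move=> /sX vX0 vX' fv; rewrite !fresh_cat fv (fresh_joins vX0 vX') (freshB vX0).1.
  have sL : size L = (size L0).+2 by rewrite (perm_size hL).
  rewrite (parity_perm hT) in pL; rewrite perm_sym in hT; apply: dec_perm hT _.
  have [xz|xz] := eqVneq x z.
    move: hc; rewrite xz eqxx /= => /eqP hc; rewrite -xz in pL *.
    have pc : parity (([set y; x], s) :: ([set w; x], s') ::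
       (spokes y (sg y) N ++ spokes w (sg w) N)) = false.
      apply: negbTE; apply: dec_parity; rewrite -[_ ++ _]cats0.
      by apply: (dec_leaves_common (R := [::])) => //; exact: dec_nil.
    apply: dec_leaves_common => //; apply: IH.
    - by move: hk; rewrite sL => /ltnW.
    - split=> // v /hdv; rewrite xz addnn oddD odd_double; exact.
    by move: pL; rewrite -!cat_cons parity_cat pc.
  apply: dec_leaves_distinct => //; try exact: fT.
  move=> r.
  have pT : perm_eq (([set x; z], r) :: total_edges X' L0) (total_edges X' (([set x; z], r) :: L0)).
    by apply/permP => P; rewrite /total_edges /= !count_cat /=; ring.
  rewrite (parity_perm pT) => hp; rewrite perm_sym in pT; apply: dec_perm pT _.
  apply: IH hp; first by move: hk; rewrite sL.
  split=> //.
    by move=> e; rewrite inE => /orP[/eqP->|/hw' //]; exists x, z.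
  move=> v /hdv; rewrite mdeg_cons !inE.
  by have [->|] := eqVneq v x; rewrite ?(negbTE xz).
have /hasP[y0 y0X _] : has predT X by case: (X) nX.
have hLv L1 R v : perm_eq L (R ++ L1) -> fresh v R -> fresh v L1 \/ odd (mdeg v L1).
  move=> hp fv; have [vX|vX] := boolP (v \in X); last by left; apply: hfresh hp vX.
  by right; have := hd v vX; rewrite (mdeg_perm _ hp) mdeg_cat; move: fv; rewrite mdeg_fresh => /eqP->.
have [||ec|[y [x [s [L1 [_ hL1 fy]]]]]] := leaf_exists (t := y0) hw.
- by move=> v _; apply: (hLv L [::]).
- exact: odd_mdeg_nfresh (hd _ y0X).
- exact: (even_cycle L [::]).
have hw1 : wf X L1 by apply: wf_sub hw => e he; rewrite (perm_mem hL1) inE he orbT.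
have [y1 [yx yX xX]] : exists y', [/\ y != x, y \in X & x \in X].
  have [|a [b [ab aX bX /=]]] := hw ([set y; x], s); first by rewrite (perm_mem hL1) mem_head.
  by case/set2_eq => [] [-> ->]; exists y => //; split; rewrite // eq_sym.
have ends L2 R w z s' : perm_eq L (R ++ ([set w; z], s') :: L2) -> w != z /\ z \in X.
  move=> hp.
  have [|a [b [ab aX bX /=]]] := hw ([set w; z], s').
    by rewrite (perm_mem hp) mem_cat mem_head orbT.
  by case/set2_eq => [] [-> ->]; split; rewrite // eq_sym.
have notin v w z s' L2 L3 : perm_eq L2 (([set w; z], s') :: L3) -> fresh v L2 ->
    [/\ v != w, v != z & fresh v L3].
  by move=> hp; rewrite (fresh_perm _ hp) fresh_cons !inE negb_or => /andP[/andP[]].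
(* If [x] has no other edge, then [xy] is a component. A search from any third vertex finds a leaf
   whose neighbour differs from [x], because [x] is isolated in [L1]. *)
have [fx|fx] := boolP (fresh x L1).
  have [/hasP[v vX /andP[vy vx]]|hX] := boolP (has (fun v => (v != y) && (v != x)) X).
    have fv : fresh v [:: ([set y; x], s)] by rewrite fresh_cons !inE negb_or vy vx.
    have ov : ~~ fresh v L1.
      move: (hd v vX); rewrite (mdeg_perm _ hL1) mdeg_cons !inE (negbTE vx) (negbTE vy).
      exact: odd_mdeg_nfresh.
    have [||ec|[w [z [s' [L2 [_ hL2 fw]]]]]] := leaf_exists (t := v) hw1.
    - move=> u _; have [->|uy] := eqVneq u y; first by left.
      have [->|ux] := eqVneq u x; first by left.
      by apply: (hLv L1 [:: ([set y; x], s)]); rewrite // fresh_cons !inE negb_or uy ux.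
    - exact: ov.
    - exact: (even_cycle L1 [:: ([set y; x], s)]).
    have [yw yz fy2] := notin _ _ _ _ _ _ hL2 fy.
    have [xw xz fx2] := notin _ _ _ _ _ _ hL2 fx.
    apply: (two_leaves y x s w z s' L2) => //; first by rewrite eq_sym.
      by apply: perm_trans hL1 _; rewrite perm_cons.
    by rewrite xz.
  have {hX} hX : perm_eq X [:: y; x].
    apply: uniq_perm => //; first by rewrite /= inE yx.
    move=> v; rewrite !inE; apply/idP/orP => [vX|[]/eqP->//].
    by move/hasPn/(_ v vX): hX; rewrite negb_and !negbK => /orP.
  have eL1 : L1 = [::].
    case: L1 {hL1 notin} fy fx hw1 => // e L1 fy fx /(_ e (mem_head _ _))[a [b [_ aX _ eab]]].
    move: fy fx; rewrite !fresh_cons eab !inE !negb_or.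
    by move: aX; rewrite (perm_mem hX) !inE => /orP[]/eqP->; rewrite eqxx.
  have hT : perm_eq (total_edges X L) (total_edges [:: y; x] [:: ([set y; x], s)]).
    by rewrite perm_cat2l perm_cat ?joins_perm // -eL1.
  rewrite (parity_perm hT) in pL; rewrite perm_sym in hT.
  by apply: dec_perm hT _; apply: base => //; exact: sX.
(* The degree of [x] in [L1] is even, so [x] must be the exempt vertex; this also makes the new leaf
   [w] different from [x]. *)
have [||ec|[w [z [s' [L2 [wx hL2 fw]]]]]] := leaf_exists (t := x) hw1.
- move=> u ux; have [->|uy] := eqVneq u y; first by left.
  by apply: (hLv L1 [:: ([set y; x], s)]); rewrite // fresh_cons !inE negb_or uy ux.
- exact: fx.
- exact: (even_cycle L1 [:: ([set y; x], s)]).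
have [yw yz fy2] := notin _ _ _ _ _ _ hL2 fy.
have hL2' : perm_eq L (([set y; x], s) :: ([set w; z], s') :: L2).
  by apply: perm_trans hL1 _; rewrite perm_cons.
have [xz|xz] := eqVneq x z; last by apply: (two_leaves y x s w z s' L2); rewrite ?xz.
subst z.
have hw2 : wf X L2 by apply: wf_sub hw1 => e he; rewrite (perm_mem hL2) inE he orbT.
(* [x] has lost two edges, so its degree in [L2] is odd and an edge remains from which to search for
   a third leaf. *)
have [||ec|[w2 [z [s2 [L3 [w2x hL3 fw2]]]]]] := leaf_exists (t := x) hw2.
- move=> u ux; have [->|uy] := eqVneq u y; first by left.
  have [->|uw] := eqVneq u w; first by left.
  apply: (hLv L2 [:: ([set y; x], s); ([set w; x], s')]) => //.
  by rewrite !fresh_cons !inE !negb_or uy ux uw.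
- apply: odd_mdeg_nfresh; move: (hd x xX); rewrite (mdeg_perm _ hL2') !mdeg_cons !inE eqxx.
  by rewrite !orbT /= negbK.
- exact: (even_cycle L2 [:: ([set y; x], s); ([set w; x], s')]).
have [yw2 yz3 fy3] := notin _ _ _ _ _ _ hL3 fy2.
have [ww2 wz3 fw3] := notin _ _ _ _ _ _ hL3 fw.
have hyw2 : perm_eq L (([set y; x], s) :: ([set w2; z], s2) :: ([set w; x], s') :: L3).
  by apply: perm_trans hL2' _; apply/permP => P; rewrite /= (permP hL3) /=; ring.
have hww2 : perm_eq L (([set w; x], s') :: ([set w2; z], s2) :: ([set y; x], s) :: L3).
  by apply: perm_trans hL2' _; apply/permP => P; rewrite /= (permP hL3) /=; ring.
have [e1|n1] := boolP ((x != z) || (leaf_parity y s == leaf_parity w2 s2)).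
  apply: (two_leaves y x s w2 z s2 (([set w; x], s') :: L3)) => //.
    by rewrite fresh_cons !inE negb_or yw yx.
  by rewrite fresh_cons !inE negb_or eq_sym ww2 w2x.
move: n1; rewrite negb_or negbK => /andP[/eqP xz n1]; subst z.
have [e2|n2] := boolP (leaf_parity y s == leaf_parity w s').
  by apply: (two_leaves y x s w x s' L2); rewrite // e2 orbT.
(* The parity at [y] differs from those at [w] and [w2], so these two agree. *)
apply: (two_leaves w x s' w2 x s2 (([set y; x], s) :: L3)) => //.
- by rewrite fresh_cons !inE negb_or eq_sym yw wx.
- by rewrite fresh_cons !inE negb_or eq_sym yw2 w2x.
by move: n1 n2; rewrite eqxx /=; do 3!case: leaf_parity.
Qed.

End Substitution.

(** * Subdivisions as signed graphs *)

(** The key separates the blocks. For the paths of a subdivision it is the unordered pair of ends,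
    since each path is listed under one orientation. *)
Lemma uniq_flatten_map (A K T : eqType) (k : A -> K) (f : A -> seq T) s :
  uniq (map k s) -> (forall a, a \in s -> uniq (f a)) ->
  (forall a b x, a \in s -> b \in s -> x \in f a -> x \in f b -> k a = k b) ->
  uniq (flatten (map f s)).
Proof.
elim: s => //= a s IH /andP[ha hs] hu hd; rewrite cat_uniq hu ?mem_head //=.
rewrite IH ?andbT //.
- apply/hasPn => x /flatten_mapP[b hb xb]; apply: contra ha => xa.
  by rewrite (hd a b x) // ?mem_head ?map_f // inE hb orbT.
- by move=> b hb; apply: hu; rewrite inE hb orbT.
by move=> b c x hb hc; apply: hd; rewrite inE ?hb ?hc orbT.
Qed.

Lemma uniq_flatten_inj (T : eqType) (ss : seq (seq T)) s1 s2 x : uniq (flatten ss) ->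
  s1 \in ss -> s2 \in ss -> x \in s1 -> x \in s2 -> s1 = s2.
Proof.
elim: ss => //= s ss IH; rewrite cat_uniq => /and3P[_ /hasPn hd hu].
rewrite !inE => /orP[/eqP->|h1] /orP[/eqP->|h2] //.
- move=> x1 x2; suff /hd : x \in flatten ss by rewrite x1.
  by apply/flattenP; exists s2.
- move=> x1 x2; suff /hd : x \in flatten ss by rewrite x2.
  by apply/flattenP; exists s1.
- exact: IH hu h1 h2.
Qed.

Lemma mem_edges (G : sgraph) (x y : G) : ([set x; y] \in edges G) = adj x y.
Proof.
rewrite inE; apply/existsP/idP => [[a /existsP[b /andP[ab /eqP/set2_eq[]]]]|xy].
- by move=> [-> ->].
- by move=> [-> ->]; rewrite adj_sym.
by exists x; apply/existsP; exists y; rewrite xy eqxx.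
Qed.

Lemma edgesP (G : sgraph) (e : {set G}) :
  reflect (exists x y, adj x y /\ e = [set x; y]) (e \in edges G).
Proof.
apply: (iffP idP) => [|[x [y [xy ->]]]]; last by rewrite mem_edges.
by rewrite inE => /existsP[x /existsP[y /andP[xy /eqP->]]]; exists x, y.
Qed.

Lemma adj_neq (G : sgraph) (x y : G) : adj x y -> x != y.
Proof. by apply: contraTneq => ->; rewrite adj_irrefl. Qed.

Definition signed (T : eqType) (r : T -> bool) (es : seq T) := [seq (e, r e) | e <- es].

Lemma signed_cat (T : eqType) (r : T -> bool) s1 s2 :
  signed r (s1 ++ s2) = signed r s1 ++ signed r s2.
Proof. exact: map_cat. Qed.

Lemma wedges_true (S : sgraph) (x : S) l :
  wedges x [seq (true, v) | v <- l] = signed xpredT (walk_edges (x :: l)).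
Proof. by elim: l x => //= v l IH x; rewrite IH. Qed.

Lemma walk_edges_next (S : sgraph) (x : S) c : uniq (x :: c) ->
  walk_edges (x :: rcons c x) = [seq [set z; next (x :: c) z] | z <- x :: c].
Proof.
move=> hu; have sz : size (walk_edges (x :: rcons c x)) = size (x :: c).
  by rewrite size_map size_zip /= size_rcons; apply/minn_idPr.
apply: (@eq_from_nth _ set0); first by rewrite sz size_map.
move=> i; rewrite sz => hi.
rewrite (nth_map x) // (nth_map (x, x)); last first.
  by rewrite -(size_map (fun ab => [set ab.1; ab.2])) -/(walk_edges _) sz.
rewrite nth_zip_cond; case: ifP => [_|]; last first.
  by rewrite -(size_map (fun ab => [set ab.1; ab.2])) -/(walk_edges _) sz hi.
rewrite next_nth mem_nth // index_uniq //=.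
rewrite -rcons_cons nth_rcons hi; congr [set _; _].
(* At the last vertex of the cycle the lookup runs past the end of [c] and returns its default [x],
   the start, which is also the final vertex of the closed walk. *)
rewrite nth_rcons; move: hi; rewrite /= ltnS leq_eqVlt => /orP[/eqP->|->//].
by rewrite ltnn eqxx nth_default.
Qed.

(** Two different vertices with the same edge to their successors would be successors of each other,
    which forces length 2. *)
Lemma next_edge_inj (S : sgraph) (c : seq S) : uniq c -> 2 < size c ->
  {in c &, injective (fun z => [set z; next c z])}.
Proof.
move=> hu hs z z' hz hz' /set2_eq[[]//|[e1 e2]].
have [i s hr] := rot_to hz.
move: e1; rewrite -e2 -2!(next_rot i hu) hr.
have := hu; rewrite -(rot_uniq i) hr => hu'.
have : 2 < size (rot i c) by rewrite size_rot.
rewrite hr; case: s {hr} hu' => [|a [|b s]] //=.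
rewrite !inE !negb_or eqxx => /andP[/and3P[za zb _] _] _.
by rewrite eq_sym (negbTE za) eqxx => zb'; rewrite zb' eqxx in zb.
Qed.

Lemma path_walk_edges (S : sgraph) (x : S) l :
  path adj x l = all (fun e => e \in edges S) (walk_edges (x :: l)).
Proof. by elim: l x => //= v l IH x; rewrite mem_edges -IH. Qed.

(** With every sign odd, the parity of a cycle is the parity of its length. *)
Lemma even_cycle_is_cycle (S : sgraph) (C : {set {set S}}) : even_cycle C ->
  is_cycle (signed xpredT (enum C)) /\ ~~ parity (signed xpredT (enum C)).
Proof.
case=> [[|x c] [] // hs /andP[_ hu] ho eC].
have pe : perm_eq (enum C) (walk_edges (x :: rcons c x)).
  rewrite walk_edges_next //; apply: uniq_perm; first exact: enum_uniq.
    by rewrite map_inj_in_uniq //; apply: next_edge_inj.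
  move=> e; rewrite mem_enum eC; apply/imsetP/mapP => -[z hz ->]; by exists z.
split.
  exists x, [seq (true, v) | v <- rcons c x]; split; last first.
    by rewrite wedges_true; apply: perm_map.
  rewrite /closed_walk size_map -map_comp map_id last_rcons eqxx size_rcons.
  rewrite rcons_uniq; move: hu hs => /= -> hs; by rewrite ltnW.
rewrite /parity count_map count_predT (perm_size pe).
by rewrite walk_edges_next // size_map.
Qed.

Lemma decomposable_dec (S : sgraph) : even_cycle_decomposable S ->
  dec (signed xpredT (enum (edges S))).
Proof.
move=> [P /and3P[/eqP hc /trivIsetP ht h0] hP].
exists [seq signed xpredT (enum C) | C : {set {set S}} <- enum P]; split.
  by move=> c /mapP[C]; rewrite mem_enum => /hP/even_cycle_is_cycle ? ->.
have -> : flatten [seq signed xpredT (enum C) | C : {set {set S}} <- enum P]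
    = signed xpredT (flatten [seq enum C | C : {set {set S}} <- enum P]).
  by rewrite /signed map_flatten -map_comp.
apply: perm_map.
apply: uniq_perm; last 1 first.
- move=> e; rewrite mem_enum -hc; apply/flatten_mapP/bigcupP => -[C hC he].
    by rewrite !mem_enum in hC he; exists C.
  by exists C; rewrite mem_enum.
- apply: (@uniq_flatten_map _ _ _ id); first by rewrite map_id enum_uniq.
    by move=> *; exact: enum_uniq.
  move=> C C' e; rewrite !mem_enum => hC hC' eC eC'.
  apply/eqP; apply/negPn/negP => /(ht _ _ hC hC')/disjoint_setI0/setP/(_ e).
  by rewrite !inE eC eC'.
- exact: enum_uniq.
Qed.

Lemma is_cycle_even_cycle (S : sgraph) (c : seq ({set S} * bool)) :
  is_cycle c -> ~~ parity c -> uniq c ->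
  {subset c <= signed xpredT (enum (edges S))} -> even_cycle [set e in map fst c].
Proof.
move=> [x [p [/and3P[h1 hl hu] hp]]]; rewrite (parity_perm hp) (perm_uniq hp).
have -> : [set e in map fst c] = [set e in map fst (wedges x p)].
  by apply/setP => e; rewrite !inE (perm_mem (perm_map fst hp)).
move=> ho uw hs.
have {hs} hs : {subset wedges x p <= signed xpredT (enum (edges S))}.
  by move=> e; rewrite -(perm_mem hp); apply: hs.
have [l el] : exists l, p = [seq (true, v) | v <- l].
  exists (map snd p); elim: (p) (x) hs => //= [[s v] q IH] y hs.
  have /mapP[e _ [_ ->]] := hs _ (mem_head _ _).
  by congr (_ :: _); apply: (IH v) => e' he'; apply: hs; rewrite inE he' orbT.
subst p; move: h1 hl hu ho uw hs; rewrite size_map -map_comp map_id.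
case/lastP: l {hp} => // l z; rewrite last_rcons => h1 /eqP -> hu.
have {hu} hu : uniq (x :: l) by move: hu; rewrite rcons_uniq.
rewrite size_rcons ltnS in h1.
rewrite wedges_true => ho uw hs.
have {uw} uw : uniq (walk_edges (x :: rcons l x)) by apply: map_uniq uw.
exists (x :: l); split.
(* A closed walk of length 2 would use one edge of the simple graph twice, against uniqueness of the
   edges. *)
- case: l h1 hu uw {ho hs} => [|a [|b l]] // _ _.
  by rewrite /= setUC inE eqxx.
- rewrite /ucycle hu andbT /= path_walk_edges; apply/allP => e he.
  have /mapP[e' he' [->]] := hs _ (map_f (fun e => (e, true)) he).
  by rewrite mem_enum in he'.
- move: ho; rewrite /parity count_map count_predT.
  by rewrite walk_edges_next // size_map.
- apply/setP => e; rewrite inE -map_comp map_id walk_edges_next //.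
  by apply/mapP/imsetP => -[z' hz ->]; exists z'.
Qed.

Lemma dec_decomposable (S : sgraph) : dec (signed xpredT (enum (edges S))) ->
  even_cycle_decomposable S.
Proof.
move=> [cs [hcs hp]].
have us : uniq (signed xpredT (enum (edges S))).
  by rewrite map_inj_uniq ?enum_uniq // => a b [].
have uf : uniq (flatten cs) by rewrite (perm_uniq hp).
have sub c : c \in cs -> {subset c <= signed xpredT (enum (edges S))}.
  by move=> hc e he; rewrite -(perm_mem hp); apply/flattenP; exists c.
have uc c : c \in cs -> uniq c.
  elim: cs uf {hcs hp sub} => //= c' cs IH; rewrite cat_uniq inE.
  by move=> /and3P[u1 _ u2] /orP[/eqP->//|]; apply: IH.
have strue c e : c \in cs -> e \in map fst c -> (e, true) \in c.
  by move=> hc /mapP[e' he' ->]; have /mapP[? _ ee] := sub c hc _ he'; rewrite ee -?ee in he' *.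
exists [set C in [seq [set e in map fst c] | c <- cs]]; last first.
  move=> C; rewrite inE => /mapP[c hc ->]; have [h1 h2] := hcs c hc.
  by apply: is_cycle_even_cycle => //; [exact: uc | exact: sub].
apply/and3P; split.
- apply/eqP/setP => e; rewrite -[RHS]mem_enum; apply/bigcupP/idP.
    move=> [C]; rewrite inE => /mapP[c hc ->]; rewrite inE => he.
    have /mapP[e' he' [->]] := sub c hc _ (strue c e hc he); exact: he'.
  move=> he; have : (e, true) \in flatten cs.
    by rewrite (perm_mem hp); apply: map_f he.
  move=> /flattenP[c hc he']; exists [set e in map fst c].
    by rewrite inE; apply: map_f.
  by rewrite inE; apply: (map_f fst he').
- apply/trivIsetP => A C; rewrite !inE => /mapP[c hc ->] /mapP[c' hc' ->] neq.
  rewrite -setI_eq0; apply/eqP/setP => e; rewrite !inE.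
  apply/negP => /andP[/(strue _ _ hc) h1 /(strue _ _ hc') h2].
  by rewrite (uniq_flatten_inj uf hc hc' h1 h2) eqxx in neq.
- rewrite inE; apply/negP => /mapP[c hc /setP h0].
  have [[x [p [/and3P[p1 _ _] /perm_size sp]]] _] := hcs c hc.
  case: c hc h0 sp => [|e c] hc h0 sp; first by case: (p) p1 sp => [|[]].
  by have := h0 e.1; rewrite !inE eqxx.
Qed.

Lemma imset_set2 (V W : finType) (g : V -> W) a b :
  g @: [set a; b] = [set g a; g b].
Proof. by rewrite imsetU1 imset_set1. Qed.

Definition map_edges (V W : finType) (g : V -> W) (L : seq ({set V} * bool)) :=
  [seq (g @: e.1, e.2) | e : {set V} * bool <- L].

(** Injectivity is required only on a set [D] containing all ends of edges: the map from a
    subdivision back to G cannot be injective on the subdividing vertices. *)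
Lemma dec_map (V W : finType) (g : V -> W) (D : pred V) (L : seq ({set V} * bool)) :
  {in D &, injective g} -> (forall e v, e \in L -> v \in e.1 -> D v) -> dec L ->
  dec (map_edges g L).
Proof.
move=> gi hD [cs [hcs hp]].
exists (map (map_edges g) cs); split; last first.
  by rewrite /map_edges -map_flatten; apply: perm_map.
move=> c' /mapP[c hc ->]; have [[x [p [/and3P[h1 /eqP hl hu] pc]]] par] := hcs c hc.
split; last by rewrite /parity count_map.
have hw y q : wedges (g y) [seq (k.1, g k.2) | k <- q] =
    map_edges g (wedges y q).
  by elim: q y => //= -[s v] q IH y /=; rewrite -IH imset_set2.
have Dp v : v \in map snd p -> D v.
  move=> hv; have [||e he hve] := @wedges_vertex _ x p v; first by case: (p) hv.
    by rewrite inE hv orbT.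
  apply: (hD e) => //; rewrite -(perm_mem hp); apply/flattenP; exists c => //.
  by rewrite (perm_mem pc).
exists (g x), [seq (k.1, g k.2) | k <- p]; split; last by rewrite hw; apply: perm_map.
rewrite /closed_walk size_map h1.
have -> : map snd [seq (k.1, g k.2) | k <- p] = map g (map snd p) by rewrite -!map_comp.
rewrite last_map hl eqxx map_inj_in_uniq //.
by move=> a b /Dp Da /Dp Db; apply: gi.
Qed.

Lemma walk_edgesP (S : sgraph) (l : seq S) (e : {set S}) :
  reflect (exists l1 a b l2, l = l1 ++ [:: a, b & l2] /\ e = [set a; b])
    (e \in walk_edges l).
Proof.
apply: (iffP idP); last first.
  move=> [l1 [a [b [l2 [-> ->]]]]]; elim: l1 => [|c [|d l1] IH] /=.
  - by rewrite inE eqxx.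
  - by rewrite !inE eqxx orbT.
  - by rewrite inE; apply/orP; right; apply: IH.
elim: l => [|a [|b l] IH] //.
rewrite -[walk_edges _]/([set a; b] :: walk_edges (b :: l)) inE.
case/orP => [/eqP->|/IH[l1 [a' [b' [l2 [-> ->]]]]]]; first by exists [::], a, b, l.
by exists (a :: l1), a', b', l2.
Qed.

Lemma walk_edges_rev (S : sgraph) (l : seq S) e :
  (e \in walk_edges (rev l)) = (e \in walk_edges l).
Proof.
suff h l' : e \in walk_edges l' -> e \in walk_edges (rev l').
  by apply/idP/idP => [/h|/h//]; rewrite revK.
move=> /walk_edgesP[l1 [a [b [l2 [-> ->]]]]]; apply/walk_edgesP.
exists (rev l2), b, a, (rev l1); split; last exact: setUC.
by rewrite rev_cat !rev_cons -!cats1 -!catA.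
Qed.

Lemma walk_edges_mem (S : sgraph) (l : seq S) e s :
  e \in walk_edges l -> s \in e -> s \in l.
Proof.
move=> /walk_edgesP[l1 [a [b [l2 [-> ->]]]]]; rewrite mem_cat !inE.
by case/orP => ->; rewrite ?orbT.
Qed.

(** The paths of a subdivision are indexed by ordered pairs; picking one order per edge lists each
    path once. *)
Lemma orientation (G : sgraph) : exists2 O : seq (G * G),
  [seq [set o.1; o.2] | o <- O] = enum (edges G) & forall o, o \in O -> adj o.1 o.2.
Proof.
have : {subset enum (edges G) <= edges G} by move=> e; rewrite mem_enum.
elim: (enum _) => [|e es IH] h; first by exists [::].
have [|O hO aO] := IH; first by move=> e' he'; apply: h; rewrite inE he' orbT.
have /edgesP[x [y [xy ->]]] := h e (mem_head _ _).
exists ((x, y) :: O); first by rewrite /= hO.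
by move=> o; rewrite inE => /orP[/eqP->|/aO].
Qed.

(** * Contracting the paths of a subdivision to signed edges *)

Section Subdivision.

Variables (G S : sgraph) (f : G -> S) (p : G -> G -> seq S).
Hypothesis sub : subdivision_by f p.

Definition sub_walk (o : G * G) := walk_edges (Defs.sub_path f p o.1 o.2).

Lemma sub_walk_internal (o : G * G) (s : S) e : adj o.1 o.2 -> e \in sub_walk o ->
  s \in e -> (s \in p o.1 o.2) || (s \in [set f o.1; f o.2]).
Proof.
move=> ao /walk_edges_mem h /h; rewrite /Defs.sub_path inE mem_rcons !inE.
by case/or3P => ->; rewrite ?orbT.
Qed.

Lemma sub_walk_nil (o : G * G) e : e \in sub_walk o ->
  e = [set f o.1; f o.2] \/ exists2 s, s \in e & s \in p o.1 o.2.
Proof.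
move=> /walk_edgesP[[|c l1] [a [b [l2 [h ->]]]]]; move: h.
  rewrite /Defs.sub_path => -[<-]; case: (p _ _) => [[<- _]|z q [<- _]]; first by left.
  by right; exists z; rewrite !inE eqxx ?orbT.
rewrite /Defs.sub_path => -[_].
rewrite -cats1 => hh; right; exists a; first by rewrite !inE eqxx.
have : size (p o.1 o.2) + 1 = size l1 + (size l2).+2.
  by have := congr1 size hh; rewrite !size_cat.
move=> hs; have hlt : size l1 < size (p o.1 o.2).
  by move: hs; rewrite addn1 addnS => -[->]; rewrite addnS ltnS leq_addr.
have := congr1 (fun l => nth a l (size l1)) hh.
by rewrite /= nth_cat hlt nth_cat ltnn subnn /= => <-; apply: mem_nth.
Qed.

(** An edge with an internal vertex determines its path because internal vertices are not shared; an
    edge without one is the image of an edge of G under the injective [f]. *)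
Lemma sub_walk_inj (o o' : G * G) e : adj o.1 o.2 -> adj o'.1 o'.2 ->
  e \in sub_walk o -> e \in sub_walk o' -> [set o.1; o.2] = [set o'.1; o'.2].
Proof.
move=> ao ao' he he'.
have nf s t u : adj t u -> s \in p t u -> s \notin [set f o.1; f o.2] /\
    s \notin [set f o'.1; f o'.2].
  move=> tu hs; split; rewrite !inE negb_or; apply/andP; split;
  by apply: contraTneq hs => ->; apply: (sub_new sub).
have [e1|[s se sp]] := sub_walk_nil he.
  have [e2|[s se sp]] := sub_walk_nil he'.
    by move: e2; rewrite e1 -!imset_set2 => /(imset_inj (sub_inj sub)).
  have [h1 h2] := nf _ _ _ ao' sp; move: (sub_walk_internal ao he se).
  by rewrite (negbTE h1) orbF => sp'; apply: (sub_disj sub ao ao' sp' sp).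
have [h1 h2] := nf _ _ _ ao sp; move: (sub_walk_internal ao' he' se).
by rewrite (negbTE h2) orbF => sp'; apply: (sub_disj sub ao ao' sp sp').
Qed.

Variable O : seq (G * G).
Hypotheses (hO : [seq [set o.1; o.2] | o <- O] = enum (edges G))
  (aO : forall o, o \in O -> adj o.1 o.2).

Lemma sub_edges_perm : perm_eq (enum (edges S)) (flatten [seq sub_walk o | o <- O]).
Proof.
have uO : uniq [seq [set o.1; o.2] | o : G * G <- O] by rewrite hO enum_uniq.
apply: uniq_perm; first exact: enum_uniq.
  apply: uniq_flatten_map; first exact: uO.
    move=> o /aO ao; have := sub_uniq sub ao; rewrite /sub_walk /Defs.sub_path => hu.
    have : uniq (wedges (f o.1) [seq (true, v) | v <- rcons (p o.1 o.2) (f o.2)]).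
      by apply: upath_wedges_uniq; rewrite -map_comp map_id.
    by rewrite wedges_true => /map_uniq.
  by move=> o o' e ho ho'; apply: sub_walk_inj; apply: aO.
move=> e; rewrite mem_enum; apply/idP/flatten_mapP; last first.
  by move=> [o /aO ao he]; apply/(sub_edge sub); exists o.1, o.2.
move=> /(sub_edge sub)[x [y [xy he]]].
have : [set x; y] \in [seq [set o.1; o.2] | o : G * G <- O] by rewrite hO mem_enum mem_edges.
case/mapP => -[a b] oO /= /set2_eq[] [ea eb]; exists (a, b) => //; rewrite /sub_walk /= -ea -eb //.
have -> : Defs.sub_path f p y x = rev (Defs.sub_path f p x y).
  by rewrite /Defs.sub_path (sub_rev sub xy) rev_cons rev_rcons.
by rewrite walk_edges_rev.
Qed.

Variable r : {set G} -> bool.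
Hypothesis hr : forall x y, adj x y -> r [set x; y] = ~~ odd (size (p x y)).

(** A path has one edge more than it has internal vertices, hence the negation in [hr]. *)
Lemma parity_sub_walk o : o \in O -> parity (signed xpredT (sub_walk o)) = r [set o.1; o.2].
Proof.
move=> /aO ao; rewrite /parity count_map count_predT hr // size_map size_zip /=.
by rewrite size_rcons (minn_idPr _).
Qed.

Let branch_edge (o : G * G) := ([set f o.1; f o.2], r [set o.1; o.2]).

Lemma parity_subdivision :
  parity (signed xpredT (enum (edges S))) = parity (signed r (enum (edges G))).
Proof.
rewrite (parity_perm (perm_map _ sub_edges_perm)) -hO.
suff main O' : {subset O' <= O} ->
  parity (signed xpredT (flatten (map sub_walk O'))) =
  parity (signed r [seq [set o.1; o.2] | o : G * G <- O']) by exact: main.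
elim: O' => //= o O' IH h.
rewrite /signed map_cat parity_cat parity_cons /= parity_sub_walk ?h ?mem_head // IH //.
by move=> o' ho'; apply: h; rewrite inE ho' orbT.
Qed.

Lemma dec_subdivision :
  dec (signed xpredT (enum (edges S))) <-> dec (map_edges f (signed r (enum (edges G)))).
Proof.
have -> : map_edges f (signed r (enum (edges G))) = map branch_edge O.
  rewrite -hO /signed /map_edges -!map_comp; apply: eq_map => o /=.
  by rewrite imset_set2.
(* [R] accumulates the contracted edges. They join branch vertices, so they avoid the internal
   vertices of the paths still to be contracted. *)
suff main O' R : {subset O' <= O} -> uniq [seq [set o.1; o.2] | o : G * G <- O'] ->
    (forall o m, o \in O' -> m \in p o.1 o.2 -> fresh m R) ->
    dec (signed xpredT (flatten (map sub_walk O')) ++ R) <-> dec (map branch_edge O' ++ R).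
  have := main O [::]; rewrite !cats0 => h; rewrite -h //; last by rewrite hO enum_uniq.
  by split; apply: dec_perm; [|rewrite perm_sym]; apply: perm_map sub_edges_perm.
elim: O' R => // o O' IH R hsub /= /andP[oO' uO'] hR.
have oO := hsub _ (mem_head _ _); have ao := aO oO.
set T := signed xpredT (flatten (map sub_walk O')).
have eo : signed xpredT (sub_walk o) =
    wedges (f o.1) [seq (true, v) | v <- rcons (p o.1 o.2) (f o.2)] by rewrite wedges_true.
have fp z : f z \notin p o.1 o.2 by apply: (sub_new sub).
have [||||q [hq pq hd]] := @dec_suppress_path _ (fun v => v \notin p o.1 o.2) (f o.1)
   [seq (true, v) | v <- rcons (p o.1 o.2) (f o.2)] (T ++ R).
- exact: fp.
- by rewrite -map_comp map_id last_rcons fp.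
- by rewrite -map_comp map_id; apply: (sub_uniq sub ao).
- move=> m; rewrite negbK => hm; rewrite fresh_cat (hR o) ?mem_head // andbT.
  apply/allP => e /mapP[e' /flatten_mapP[o' ho' he'] ->] /=; apply/negP => me.
  have ao' : adj o'.1 o'.2 by apply: aO; apply: hsub; rewrite inE ho' orbT.
  have /orP[m'|] := sub_walk_internal ao' he' me.
    case/negP: oO'; rewrite (sub_disj sub ao ao' hm m').
    by apply: (map_f (fun o : G * G => [set o.1; o.2])).
  by rewrite !inE => /orP[]/eqP em; move: hm; rewrite em (negbTE (fp _)).
move: hq; rewrite -map_comp map_id filter_rcons fp.
have -> : [seq v <- p o.1 o.2 | v \notin p o.1 o.2] = [::].
  by apply/eqP; rewrite -[_ == _]negbK -has_filter; apply/hasPn => v ->.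
case: q pq hd => [|[s v] [|? ?]] //= pq hd [ev]; subst v.
have es : s = r [set o.1; o.2].
  by rewrite -parity_sub_walk // eo -pq parity_cons addbF.
rewrite -eo es in hd.
rewrite /signed map_cat -/(signed _ _) -/(signed _ _) -/T -catA.
apply: (iff_trans (iff_sym hd)).
have pe L : perm_eq (([set f o.1; f o.2], r [set o.1; o.2]) :: L ++ R)
     (L ++ branch_edge o :: R).
  by rewrite -cat1s perm_sym -cat1s perm_catCA.
have [||h1 h2] := IH (branch_edge o :: R) _ uO'.
- by move=> o' ho'; apply: hsub; rewrite inE ho' orbT.
- move=> o' m ho' hm; have fm : fresh m R by apply: (hR o') => //; rewrite inE ho' orbT.
  rewrite fresh_cons fm andbT !inE negb_or.
  have ao' : adj o'.1 o'.2 by apply: aO; apply: hsub; rewrite inE ho' orbT.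
  by apply/andP; split; apply: contraTneq hm => ->; apply: (sub_new sub).
have pe' L := eq_ind _ is_true (pe L) _ (perm_sym _ _).
split=> h; first by apply: (dec_perm (pe' _) (h1 (dec_perm (pe _) h))).
by apply: (dec_perm (pe' _) (h2 (dec_perm (pe _) h))).
Qed.

End Subdivision.

Definition signed_decomposable (G : sgraph) := forall r : {set G} -> bool,
  ~~ parity (signed r (enum (edges G))) -> dec (signed r (enum (edges G))).

Lemma signed_strongly (G : sgraph) :
  signed_decomposable G -> strongly_even_cycle_decomposable G.
Proof.
move=> hG S [f [p sub]] hS; apply: dec_decomposable.
have [O hO aO] := orientation G.
(* The sign is well defined on unordered pairs because reversing a path keeps its length. *)
pose r (e : {set G}) := [exists x, exists y,
  [&& adj x y, e == [set x; y] & ~~ odd (size (p x y))]].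
have hr x y : adj x y -> r [set x; y] = ~~ odd (size (p x y)).
  move=> xy; apply/existsP/idP => [[a /existsP[b /and3P[ab /eqP/set2_eq]]]|h].
    by case=> [] [-> ->] //; rewrite (sub_rev sub ab) size_rev.
  by exists x; apply/existsP; exists y; rewrite xy eqxx.
apply/(dec_subdivision sub hO aO hr); apply: (dec_map (D := predT)) => //.
  by move=> a b _ _; apply: (sub_inj sub).
apply: hG; rewrite -(parity_subdivision sub hO aO hr) /parity count_map count_predT.
by rewrite -cardE.
Qed.

(** * A subdivision realizing a given signature *)

Section SignedSubdivision.

Variables (G : sgraph) (r : {set G} -> bool).

Definition even_edge := {e : {set G} | (e \in edges G) && ~~ r e}.

Definition ssub_adj : rel (G + even_edge)%type := fun a b =>
  match a, b with
  | inl x, inl y => adj x y && r [set x; y]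
  | inl x, inr e | inr e, inl x => x \in val e
  | inr _, inr _ => false
  end.

Lemma ssub_sym : symmetric ssub_adj.
Proof. by move=> [x|e] [y|e'] //=; rewrite adj_sym setUC. Qed.

Lemma ssub_irrefl : irreflexive ssub_adj.
Proof. by move=> [x|e] //=; rewrite adj_irrefl. Qed.

Lemma ssub_gt0 : 0 < #|{: G + even_edge}|.
Proof. by rewrite card_sum addn_gt0 vertex_gt0. Qed.

(* Every edge on which r is false is subdivided once, so that the length of the
   path replacing e has the parity of r e. *)
Definition ssub : sgraph := SGraph ssub_sym ssub_irrefl ssub_gt0.

Definition ssub_path (x y : G) : seq ssub :=
  if insub [set x; y] is Some e then [:: inr (e : even_edge)] else [::].

Lemma ssub_pathE x y : adj x y ->
  (r [set x; y] /\ ssub_path x y = [::]) \/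
  (~~ r [set x; y] /\ exists2 e : even_edge, val e = [set x; y] & ssub_path x y = [:: inr e]).
Proof.
move=> xy; rewrite /ssub_path; case: insubP => [e|].
  by rewrite mem_edges xy => /= hr ee; right; split=> //; exists e.
by rewrite mem_edges xy /= negbK => hr; left.
Qed.

Lemma ssub_subdivision : subdivision_by (inl : G -> ssub) ssub_path.
Proof.
split.
- by move=> x y [].
- by move=> x y _; rewrite /ssub_path setUC; case: insub.
- move=> x y xy; have xny := adj_neq xy.
  have inlN : (inl x : ssub) != inl y by apply: contraNneq xny => -[->].
  rewrite /Defs.sub_path /=; case: (ssub_pathE xy) => -[_].
    by move=> ->; rewrite /= inE inlN.
  by move=> [e _ ->] /=; rewrite !inE negb_or inlN.
- move=> x y z xy; case: (ssub_pathE xy) => -[_]; first by move=> ->.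
  by move=> [e _ ->]; rewrite inE.
- move=> x y x' y' s xy xy'; case: (ssub_pathE xy) => -[_]; first by move=> ->.
  move=> [e ee ->]; rewrite inE => /eqP->.
  case: (ssub_pathE xy') => -[_]; first by move=> ->.
  by move=> [e' ee' ->]; rewrite inE => /eqP[ee2]; rewrite -ee -ee' ee2.
- move=> [x|e]; first by left; exists x.
  right; have /andP[/edgesP[x [y [xy ee]]] hr] := valP e.
  exists x, y; split => //; case: (ssub_pathE xy) => -[]; first by rewrite -ee (negbTE hr).
  move=> _ [e' ee' ->]; rewrite inE; apply/eqP; congr inr; apply: val_inj.
  by rewrite ee' ee.
move=> E; split.
  move=> /edgesP[a [b [ab ->]]].
  have inr_case (x : G) (e : even_edge) : x \in val e -> exists x0 y : G,
      adj x0 y /\ [set (inl x : ssub); (inr e : ssub)] \in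
        walk_edges (Defs.sub_path (inl : G -> ssub) ssub_path x0 y).
    move=> xe; have /andP[/edgesP[a' [b' [ab' ee]]] hr] := valP e.
    exists a', b'; split => //; case: (ssub_pathE ab') => -[]; first by rewrite -ee (negbTE hr).
    move=> _ [e' ee' hp]; have -> : e = e' by apply: val_inj; rewrite ee' ee.
    move: xe; rewrite ee /Defs.sub_path hp /walk_edges /= !inE.
    by case/orP => /eqP->; rewrite ?eqxx // (setUC [set inr e']) eqxx orbT.
  case: a b ab => [x|e] [y|e'] //= ab.
  - case/andP: ab => xy rxy; exists x, y; split => //.
    case: (ssub_pathE xy) => -[]; last by rewrite rxy.
    by move=> _ hp; rewrite /Defs.sub_path hp /walk_edges /= inE.
  - exact: inr_case.
  - by rewrite setUC; apply: inr_case.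
move=> [x [y [xy]]]; rewrite /Defs.sub_path.
case: (ssub_pathE xy) => -[hr].
  move=> ->; rewrite /walk_edges /= mem_seq1 => /eqP->.
  by rewrite (mem_edges (G := ssub)) /= xy.
move=> [e ee ->]; rewrite /walk_edges /= in_cons mem_seq1 => /orP[]/eqP->;
by rewrite (mem_edges (G := ssub)) /= ee !inE eqxx ?orbT.
Qed.

End SignedSubdivision.

Lemma strongly_signed (G : sgraph) :
  strongly_even_cycle_decomposable G -> signed_decomposable G.
Proof.
move=> hG r hr; have [O hO aO] := orientation G.
have sub := ssub_subdivision r.
have hp x y : adj x y -> r [set x; y] = ~~ odd (size (ssub_path r x y)).
  by case/(ssub_pathE r) => -[]; [move=> -> ->|move=> /negbTE-> [e _ ->]].
have hS : ~~ odd #|edges (ssub r)|.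
  move: hr; rewrite -(parity_subdivision sub hO aO hp) /parity count_map count_predT.
  by rewrite -cardE.
have := decomposable_dec (hG (ssub r) (ex_intro _ _ (ex_intro _ _ sub)) hS).
move/(dec_subdivision sub hO aO hp).
have /card_gt0P[x0 _] := vertex_gt0 G.
(* A left inverse of the embedding of G; [x0] is an arbitrary value at the subdividing vertices,
   which carry no edge of the embedded graph. *)
pose g (s : ssub r) := if s is inl x then x else x0.
move/(dec_map (g := g) (D := fun s => if s is inl _ then true else false)).
have -> : map_edges g (map_edges inl (signed r (enum (edges G)))) = signed r (enum (edges G)).
  rewrite /map_edges /signed -!map_comp; apply: eq_map => e /=; congr (_, _).
  by rewrite -imset_comp -[RHS]imset_id; apply: eq_imset.
apply; first by move=> [x|?] [y|?] //= _ _ ->.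
by move=> e s /mapP[e' _ ->] /= /imsetP[x _ ->].
Qed.

(** * Twin substitution *)

Lemma mdeg_degree (G : sgraph) (r : {set G} -> bool) (v : G) :
  mdeg v (signed r (enum (edges G))) = degree v.
Proof.
rewrite /mdeg count_map -size_filter.
have /perm_size-> : perm_eq (filter (fun e : {set G} => v \in e) (enum (edges G)))
    [seq [set v; y] | y <- enum [set y | adj v y]].
  apply: uniq_perm; first by rewrite filter_uniq ?enum_uniq.
    rewrite map_inj_in_uniq ?enum_uniq // => a b _ _ /set2_eq[[]//|[-> ->]] //.
  move=> e; rewrite mem_filter mem_enum; apply/andP/mapP => [[ve /edgesP[a [b [ab ee]]]]|].
    move: ve; rewrite ee !inE => /orP[]/eqP->; first by exists b; rewrite ?mem_enum ?inE.
    by exists a; rewrite ?mem_enum ?inE 1?adj_sym // setUC.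
  by move=> [y]; rewrite mem_enum inE => vy ->; rewrite mem_edges !inE eqxx.
by rewrite size_map -cardE.
Qed.

Section TwinSubst.

Variables (G : sgraph) (u v : G) (H : sgraph).
Hypotheses (huv : twins u v) (hadj : adj u v).

Let W := {x : G | (x != u) && (x != v)}.
Let TS := twin_subst u v H.

Definition tsl (x : W) : TS := inl x.
Definition tsr (h : H) : TS := inr h.
Definition is_tsr : pred TS := fun a => if a is inr _ then true else false.

Definition ts_nbrs : seq TS := [seq tsl w | w <- enum [pred w : W | adj v (val w)]].
Definition ts_outer : seq {set TS} :=
  [seq e : {set TS} <- enum (edges TS) | [forall a in e, ~~ is_tsr a]].
Definition ts_cross (X : seq TS) : seq {set TS} :=
  flatten [seq [seq [set h; n] | n <- ts_nbrs] | h <- X].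

Lemma tsr_inj : injective tsr. Proof. by move=> a b []. Qed.
Lemma tsl_inj : injective tsl. Proof. by move=> a b []. Qed.

Lemma ts_nbrsP a : reflect (exists2 w : W, adj v (val w) & a = tsl w) (a \in ts_nbrs).
Proof.
apply: (iffP mapP) => -[w hw ->]; exists w; move: hw; by rewrite // mem_enum inE.
Qed.

Lemma ts_outerP e : reflect (exists x y : W, adj (val x) (val y) /\ e = [set tsl x; tsl y])
  (e \in ts_outer).
Proof.
rewrite mem_filter mem_enum; apply: (iffP andP) => [[h /edgesP[a [b [ab ee]]]]|].
  move/forall_inP: h; rewrite ee => h.
  have := h a; have := h b; rewrite !inE !eqxx orbT => /(_ isT) hb /(_ isT) ha.
  by case: a b ab {ee h} ha hb => [x|?] [y|?] //= xy _ _; exists x, y.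
move=> [x [y [xy ->]]]; rewrite mem_edges; split => //.
by apply/forall_inP => a; rewrite !inE => /orP[]/eqP->.
Qed.

Lemma ts_crossP X e : reflect (exists h (w : W), [/\ h \in X, adj v (val w) & e = [set h; tsl w]])
  (e \in ts_cross X).
Proof.
apply: (iffP flatten_mapP) => [[h hX /mapP[n /ts_nbrsP[w vw ->] ->]]|[h [w [hX vw ->]]]].
  by exists h, w.
by exists h => //; apply: map_f; apply/ts_nbrsP; exists w.
Qed.

Lemma ts_edges_uniq X (I : seq {set TS}) : uniq X -> all is_tsr X -> uniq I ->
  (forall e, e \in I -> exists a b, [/\ is_tsr a, is_tsr b & e = [set a; b]]) ->
  uniq (ts_outer ++ (ts_cross X ++ I)).
Proof.
move=> uX /allP hX uI hI; rewrite !cat_uniq uI filter_uniq ?enum_uniq //= andbT.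
have cr e : e \in ts_cross X -> exists h w, [/\ is_tsr h, h \in X & e = [set h; tsl w]].
  by move=> /ts_crossP[h [w [hX' _ ->]]]; exists h, w; rewrite hX.
apply/and3P; split.
- apply/hasPn => e; rewrite mem_cat => he; apply/ts_outerP => -[x [y [_ ee]]].
  case/orP: he => [/cr[h [w [hr _]]]|/hI[a [b [ha _]]]]; rewrite ee.
    by move/set2_eq => [] [ex ey]; [rewrite -ex in hr | rewrite -ey in hr].
  by move/set2_eq => [] [ex ey]; [rewrite -ex in ha | rewrite -ey in ha].
- apply: (@uniq_flatten_map _ _ _ id); first by rewrite map_id.
    move=> h _; rewrite map_inj_uniq.
      by rewrite map_inj_uniq ?enum_uniq //; apply: tsl_inj.
    by move=> a b /set2_eq[[]//|[-> ->]].
  move=> h h' e /hX hh /hX hh' /mapP[n /ts_nbrsP[w _ ->] ->].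
  move=> /mapP[n' /ts_nbrsP[w' _ ->]] /set2_eq[[]//|[eh _]].
  by rewrite eh in hh.
- apply/hasPn => e /hI[a [b [ha hb ->]]]; apply/negP => /cr[h [w [_ _ /set2_eq]]].
  by case=> [] [ea eb]; [rewrite eb in hb | rewrite ea in ha].
Qed.

Definition ts_inner : seq {set TS} := [seq tsr @: e | e : {set H} <- enum (edges H)].

Lemma ts_innerP e : reflect (exists x y : H, adj x y /\ e = [set tsr x; tsr y]) (e \in ts_inner).
Proof.
apply: (iffP mapP) => [[e']|[x [y [xy ->]]]].
  by rewrite mem_enum => /edgesP[x [y [xy ->]]] ->; exists x, y; rewrite imset_set2.
by exists [set x; y]; rewrite ?mem_enum ?mem_edges ?imset_set2.
Qed.

Definition ts_new : seq TS := map tsr (enum H).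

Lemma ts_edges_perm :
  perm_eq (enum (edges TS)) (ts_outer ++ (ts_cross ts_new ++ ts_inner)).
Proof.
apply: uniq_perm; first exact: enum_uniq.
  apply: ts_edges_uniq.
  - by rewrite map_inj_uniq ?enum_uniq //; apply: tsr_inj.
  - by apply/allP => a /mapP[h _ ->].
  - by rewrite map_inj_uniq ?enum_uniq //; apply: imset_inj tsr_inj.
  - by move=> e /ts_innerP[x [y [_ ->]]]; exists (tsr x), (tsr y).
have newX h : tsr h \in ts_new by apply: map_f; rewrite mem_enum.
move=> e; rewrite mem_enum !mem_cat; apply/edgesP/or3P.
  move=> [[x|x] [[y|y] [xy ->]]].
  - by apply: Or31; apply/ts_outerP; exists x, y.
  - by apply: Or32; apply/ts_crossP; exists (tsr y), x; rewrite setUC.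
  - by apply: Or32; apply/ts_crossP; exists (tsr x), y.
  - by apply: Or33; apply/ts_innerP; exists x, y.
case=> [/ts_outerP[x [y [xy ->]]]|/ts_crossP[h [w [/mapP[h' _ ->] vw ->]]]|
        /ts_innerP[x [y [xy ->]]]].
- by exists (tsl x), (tsl y).
- by exists (tsr h'), (tsl w).
- by exists (tsr x), (tsr y).
Qed.

(** [u] goes to [x] and [v] to [y]. These need not be adjacent in [TS], as the last remaining edge
    of the induction may be virtual. *)
Definition ts_embed (x y : TS) (w : G) : TS :=
  if insub w is Some w' then tsl w' else if w == u then x else y.

(** * The copy of G on two substituted vertices *)

Section Embed.

Variables x y : TS.
Hypotheses (xr : is_tsr x) (yr : is_tsr y) (xy : x != y).

Let phi := ts_embed x y.

Let uv : u != v. Proof. by case: huv. Qed.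

Lemma ts_embed_u : phi u = x.
Proof. by rewrite /phi /ts_embed insubN ?eqxx. Qed.

Lemma ts_embed_v : phi v = y.
Proof. by rewrite /phi /ts_embed insubN ?eqxx ?andbF // eq_sym (negbTE uv). Qed.

Lemma ts_embed_val (w : W) : phi (val w) = tsl w.
Proof. by rewrite /phi /ts_embed valK. Qed.

Lemma ts_embedP (w : G) : [\/ w = u, w = v | exists w' : W, w = val w'].
Proof.
have [->|wu] := eqVneq w u; first exact: Or31.
have [->|wv] := eqVneq w v; first exact: Or32.
have hw : (w != u) && (w != v) by rewrite wu.
by apply: Or33; exists (Sub w hw); rewrite SubK.
Qed.

Lemma ts_embed_inj : injective phi.
Proof.
have lx w : tsl w <> x by move=> e; move: xr; rewrite -e.
have ly w : tsl w <> y by move=> e; move: yr; rewrite -e.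
move=> a b; case: (ts_embedP a) => [->|->|[a' ->]]; case: (ts_embedP b) => [->|->|[b' ->]];
rewrite ?ts_embed_u ?ts_embed_v ?ts_embed_val //; try by move=> e; have := xy; rewrite e eqxx.
- by move=> e; case: (lx b').
- by move=> e; case: (ly b').
- by move/lx.
- by move/ly.
- by move/tsl_inj->.
Qed.

(** Outer adjacency in [TS] is defined from [v] alone; that [u] is its twin makes the edges at [x]
    come out right, and the adjacency of [u] and [v] accounts for [[set x; y]]. *)
Lemma ts_embed_edges : perm_eq [seq phi @: e | e : {set G} <- enum (edges G)]
  (ts_outer ++ (ts_cross [:: x; y] ++ [:: [set x; y]])).
Proof.
have tw (w : W) : adj u (val w) = adj v (val w).
  by case: huv => _; apply; have /andP[] := valP w.
apply: uniq_perm.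
- by rewrite map_inj_uniq ?enum_uniq //; apply: imset_inj ts_embed_inj.
- apply: ts_edges_uniq; rewrite //= ?xr ?yr // ?inE ?xy //.
  by move=> e; rewrite inE => /eqP->; exists x, y.
move=> e; rewrite 2!mem_cat mem_seq1; apply/mapP/or3P.
  move=> [e' ]; rewrite mem_enum => /edgesP[a [b [ab ->]]] ->; rewrite imset_set2.
  have cr c (w : W) : c \in [:: x; y] -> adj v (val w) ->
     [\/ [set c; tsl w] \in ts_outer, [set c; tsl w] \in ts_cross [:: x; y]
       | [set c; tsl w] == [set x; y]].
    by move=> hc vw; apply: Or32; apply/ts_crossP; exists c, w.
  case: (ts_embedP a) ab => [->|->|[a' ->]]; case: (ts_embedP b) => [->|->|[b' ->]];
    rewrite ?ts_embed_u ?ts_embed_v ?ts_embed_val ?adj_irrefl // => ab.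
  - exact: Or33.
  - by apply: cr; rewrite ?mem_head // -tw.
  - by apply: Or33; rewrite setUC.
  - by apply: cr; rewrite // !inE eqxx orbT.
  - by rewrite setUC; apply: cr; rewrite ?mem_head // -tw adj_sym.
  - by rewrite setUC; apply: cr; rewrite ?inE ?eqxx ?orbT // adj_sym.
  - by apply: Or31; apply/ts_outerP; exists a', b'.
case=> [/ts_outerP[a [b [ab ->]]]|/ts_crossP[h [w [hh vw ->]]]|/eqP->].
- by exists [set val a; val b]; rewrite ?imset_set2 ?ts_embed_val // mem_enum mem_edges.
- move: hh; rewrite !inE => /orP[]/eqP->.
    exists [set u; val w]; first by rewrite mem_enum mem_edges tw.
    by rewrite imset_set2 ts_embed_u ts_embed_val.
  exists [set v; val w]; first by rewrite mem_enum mem_edges.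
  by rewrite imset_set2 ts_embed_v ts_embed_val.
- exists [set u; v]; first by rewrite mem_enum mem_edges.
  by rewrite imset_set2 ts_embed_u ts_embed_v.
Qed.

End Embed.

Lemma ts_nbrs_size : degree v = (size ts_nbrs).+1.
Proof.
rewrite /degree (cardsD1 u) inE adj_sym hadj add1n; congr _.+1.
rewrite size_map -cardE -(card_imset _ val_inj); apply: eq_card => w.
rewrite !inE; apply/andP/imsetP => [[wu vw]|[w' hw ->]]; last first.
  by have /andP[-> _] := valP w'; move: hw; rewrite inE.
have hw : (w != u) && (w != v) by rewrite wu eq_sym adj_neq.
by exists (Sub w hw : W); rewrite ?inE SubK.
Qed.

Lemma signed_joins (r : {set TS} -> bool) X :
  signed r (ts_cross X) = joins ts_nbrs (fun a b => r [set a; b]) X.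
Proof.
rewrite /signed map_flatten /joins -map_comp; congr flatten.
by apply: eq_map => h /=; rewrite -map_comp.
Qed.

Lemma twin_subst_signed : 4 <= degree v -> signed_decomposable G -> anti_eulerian H ->
  signed_decomposable TS.
Proof.
move=> hdv hG hH r.
have hp := perm_map (fun e => (e, r e)) ts_edges_perm.
rewrite -!/(signed _ _) in hp.
rewrite (parity_perm hp) => hr; apply: (dec_perm (L := signed r _)).
  by rewrite perm_sym; exact: hp.
(* The signature [xpred0] is trivially even, so G decomposes into cycles and its degrees are
   even. *)
have dv : ~~ odd (degree v).
  rewrite -(mdeg_degree xpred0); apply: dec_mdeg; apply: hG.
  by rewrite /parity count_map count_pred0.
have uN : uniq ts_nbrs by rewrite map_inj_uniq ?enum_uniq //; apply: tsl_inj.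
have oN : odd (size ts_nbrs) by move: dv; rewrite ts_nbrs_size /= negbK.
have sN : 2 < size ts_nbrs by move: hdv; rewrite ts_nbrs_size.
have eT (X : seq TS) (I : seq {set TS}) :
   signed r (ts_outer ++ (ts_cross X ++ I)) =
   total_edges (signed r ts_outer) ts_nbrs (fun a b => r [set a; b]) X (signed r I).
  by rewrite /total_edges -signed_joins -!signed_cat.
rewrite eT in hr *.
apply: (dec_substitution uN oN sN (X0 := is_tsr)) hr.
- move=> a ha; split.
    apply/allP => e /mapP[e' /ts_outerP[x [y [_ ->]]] ->] /=.
    by rewrite !inE; apply/norP; split; apply: contraTneq ha => ->.
  by apply/ts_nbrsP => -[w _ e]; rewrite e in ha.
- move=> x y s xy xr yr.
  (* [s] need not be the value of [r] at the pair [[set x; y]], which may not even be an edge of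
     [TS]. Changing this one value is harmless, as the pair is neither an outer nor a cross edge. *)
  pose r' e := if e == [set x; y] then s else r e.
  have eq_r' I : [set x; y] \notin I -> signed r' I = signed r I.
    move=> hI; apply/eq_in_map => e he; rewrite /r' ifN //.
    by apply: contraNneq hI => <-.
  have -> : total_edges (signed r ts_outer) ts_nbrs (fun a b => r [set a; b]) [:: x; y]
      [:: ([set x; y], s)] = signed r' (ts_outer ++ (ts_cross [:: x; y] ++ [:: [set x; y]])).
    have nc : [set x; y] \notin ts_cross [:: x; y].
      apply/ts_crossP => -[h [w [_ _ /set2_eq]]].
      by case=> [] [ea eb]; [rewrite eb in yr | rewrite ea in xr].
    have no : [set x; y] \notin ts_outer.
      apply/ts_outerP => -[a [b [_ /set2_eq]]].
      by case=> [] [ea eb]; rewrite ea in xr.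
    rewrite 2!signed_cat (eq_r' _ no) (eq_r' _ nc) /total_edges.
    by rewrite signed_joins /= /r' eqxx.
  have pe := perm_map (fun e => (e, r' e)) (ts_embed_edges xr yr xy).
  rewrite -!/(signed _ _) in pe.
  rewrite -(parity_perm pe) => hpar; apply: dec_perm pe _.
  have -> : signed r' [seq ts_embed x y @: e | e : {set G} <- enum (edges G)] =
     map_edges (ts_embed x y) (signed (fun e : {set G} => r' (ts_embed x y @: e)) (enum (edges G))).
    by rewrite /signed /map_edges -!map_comp; apply: eq_map.
  apply: (dec_map (D := predT)) => //.
    by move=> a b _ _; apply: ts_embed_inj.
  by apply: hG; move: hpar; rewrite /parity !count_map.
split.
- by rewrite map_inj_uniq ?enum_uniq //; apply: tsr_inj.
- by rewrite -size_eq0 size_map -cardE -lt0n vertex_gt0.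
- by move=> a /mapP[h _ ->].
- move=> e /mapP[e' /ts_innerP[x [y [xy ->]]] ->]; exists (tsr x), (tsr y); split => //.
  + by rewrite (inj_eq tsr_inj) adj_neq.
  + by apply: map_f; rewrite mem_enum.
  + by apply: map_f; rewrite mem_enum.
move=> a /mapP[h _ ->].
have -> : mdeg (tsr h) (signed r ts_inner) = degree h.
  rewrite -(mdeg_degree xpredT) /mdeg !count_map; apply: eq_count => e /=.
  by rewrite mem_imset //; apply: tsr_inj.
exact: hH.
Qed.

End TwinSubst.

Theorem theorem6p2 (G : sgraph) (u v : G) (H : sgraph)
  (hG : strongly_even_cycle_decomposable G)
  (huv : twins u v) (hadj : adj u v)
  (hdu : 4 <= degree u) (hdv : 4 <= degree v)
  (hH : anti_eulerian H) :
  strongly_even_cycle_decomposable (twin_subst u v H).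
Proof.
apply: signed_strongly; apply: twin_subst_signed => //; exact: strongly_signed.
Qed.
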